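(* Let $0<a\le b\le2$, let $\alpha:\mathbf{R}\to[a,b]$ be continuous, let $\lambda>0$ and $1/a<H<1$. Then for every $u\in\mathbf{R}$ the linear tempered fractional multistable motion $X_{H,\alpha(x),\lambda}(t)$, $t\in\mathbf{R}$, is $H$-localisable at $u$ with local form (tangent process) $$X(t)=\int_{-\infty}^\infty\Big[(t-x)_+^{H-\frac1{\alpha(u)}}-(-x)_+^{H-\frac1{\alpha(u)}}\Big]dZ_{\alpha(u)}(x),$$ where $dZ_{\alpha(u)}(x)$ is a symmetric $\alpha(u)$-stable random measure.
   Context: Conventions: $(x)_+=\max\{x,0\}$ and $0^\gamma=0$ for all $\gamma\in\mathbf{R}$. Set $$G_{H,\alpha(x),\lambda}(t,x)=e^{-\lambda(t-x)_+}(t-x)_+^{H-\frac1{\alpha(x)}}-e^{-\lambda(-x)_+}(-x)_+^{H-\frac1{\alpha(x)}} .$$ The linear tempered fractional multistable motion (LTFmSM) is the multistable stochastic integral $X_{H,\alpha(x),\lambda}(t)=\int_{-\infty}^\infty G_{H,\alpha(x),\lambda}(t,x)\,dM_\alpha(x)$, $t\in\mathbf{R}$, i.e. the process with finite-dimensional distributions $$\mathbf{E}\Big[e^{i\sum_{k=1}^d\theta_kX_{H,\alpha(x),\lambda}(t_k)}\Big]=\exp\Big\{-\int_{-\infty}^\infty\Big|\sum_{k=1}^d\theta_kG_{H,\alpha(x),\lambda}(t_k,x)\Big|^{\alpha(x)}dx\Big\}.$$ For a constant $\alpha\in(0,2]$, the symmetric $\alpha$-stable random measure $dZ_\alpha$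 has control measure $dx$ and is normalized so that $\mathbf{E}[e^{i\int f\,dZ_\alpha}]=\exp\{-\int_{-\infty}^\infty|f(x)|^\alpha dx\}$ for $f\in L^\alpha(\mathbf{R})$. A process $X(t)$, $t\in\mathbf{R}$, is $h$-localisable at $u$, with $h>0$, if there is a non-trivial process $X_u'$ (the tangent process or local form of $X$ at $u$) such that, as $r\searrow0$, the processes $v\mapsto\frac{X(u+rv)-X(u)}{r^h}$ converge to $v\mapsto X_u'(v)$ in finite-dimensional distributions. *)

(* Defs.v *)
From HB Require Import structures.
From mathcomp Require Import all_boot all_order all_algebra.
From mathcomp Require Import complex.
From mathcomp Require Import all_classical all_reals all_analysis.

Set Implicit Arguments.
Unset Strict Implicit.
Unset Printing Implicit Defensive.

Import Order.TTheory GRing.Theory Num.Theory.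
Import numFieldNormedType.Exports.

Local Open Scope classical_set_scope.
Local Open Scope ring_scope.

Definition pos_part {R : realType} (x : R) : R := Num.max x 0.

                                                                          
                                  
Definition pos_pow {R : realType} (x g : R) : R :=
  if 0 < x then x `^ g else 0.

Definition G {R : realType} (H : R) (alpha : R -> R) (lambda t x : R) : R :=
  expR (- (lambda * pos_part (t - x))) * pos_pow (t - x) (H - (alpha x)^-1)
  - expR (- (lambda * pos_part (- x))) * pos_pow (- x) (H - (alpha x)^-1).

Definition stable_kernel {R : realType} (H a t x : R) : R :=
  pos_pow (t - x) (H - a^-1) - pos_pow (- x) (H - a^-1).

Section processes.
Context {R : realType} {d : measure_display} {T : measurableType d}
  (P : probability T R).

                 
Definition expect_cis (Y : T -> R) : R[i] :=
  ((\int[P]_w cos (Y w)) +i* (\int[P]_w sin (Y w)))%C.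

                                                                        
                
Definition mutually_independent (n : nat) (X : 'I_n -> T -> R) : Prop :=
  forall B : 'I_n -> set R, (forall k, measurable (B k)) ->
    P (\bigcap_(k in [set: 'I_n]) (X k @^-1` B k)) =
    (\prod_(k < n) P (X k @^-1` B k))%E.

                                                                     
                                                                          
                                                              
Definition is_LTFmSM (H : R) (alpha : R -> R) (lambda : R)
    (X : R -> {RV P >-> R}) : Prop :=
  forall (n : nat) (theta t : 'I_n -> R),
    expect_cis (fun w => \sum_(k < n) theta k * X (t k) w) =
    ((expR (- \int[lebesgue_measure]_x
        (`|\sum_(k < n) theta k * G H alpha lambda (t k) x| `^ alpha x)))%:C)%C.

Definition finite_borel (A : set R) : Prop :=
  measurable A /\ (lebesgue_measure A < +oo)%E.

                                                                      
                                                                            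
                                                  
                                                                              
                     
Definition stable_random_measure (a : R) (Z : set R -> {RV P >-> R}) : Prop :=
  [/\ forall A, finite_borel A -> forall theta : R,
        expect_cis (fun w => theta * Z A w) =
        ((expR (- (`|theta| `^ a * fine (lebesgue_measure A))))%:C)%C,
      forall (n : nat) (A : 'I_n -> set R), (forall k, finite_borel (A k)) ->
        trivIset [set: 'I_n] A ->
        mutually_independent (fun k => Z (A k) : T -> R) &
      forall A : nat -> set R, (forall k, finite_borel (A k)) ->
        trivIset [set: nat] A -> finite_borel (\bigcup_k A k) ->
        {ae P, forall w, (fun n => \sum_(k < n) Z (A k) w) @ \oo -->
                         Z (\bigcup_k A k) w}].

                                                                          
                                                                 
                                                             
Definition is_stable_integral (a : R) (Z : set R -> {RV P >-> R})
    (f : R -> R) (I : {RV P >-> R}) : Prop :=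
  [/\ measurable_fun setT f,
      (\int[lebesgue_measure]_x (`|f x| `^ a)%:E < +oo)%E &
      exists (m : nat -> nat) (c : nat -> nat -> R) (A : nat -> nat -> set R),
      [/\ forall n k, finite_borel (A n k),
          (\int[lebesgue_measure]_x
             (`|\sum_(k < m n) c n k * \1_(A n k) x - f x| `^ a)%:E)%E
            @[n --> \oo] --> 0%E &
          forall e : R, 0 < e ->
            P [set w | e <= `|\sum_(k < m n) c n k * Z (A n k) w - I w|]
            @[n --> \oo] --> 0%E]].

Definition nontrivial_process (Y : R -> {RV P >-> R}) : Prop :=
  exists v : R, ~ {ae P, forall w, Y v w = 0}.

End processes.

                                                                             
                                                                                
Definition fdd_cvg {R : realType}
    {d : measure_display} {T : measurableType d} (P : probability T R)
    {d' : measure_display} {T' : measurableType d'} (P' : probability T' R)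
    (X : R -> R -> T -> R) (Y : R -> T' -> R) : Prop :=
  forall (n : nat) (v : 'I_n -> R) (f : 'rV[R]_n -> R),
    continuous f -> (exists M : R, forall x, `|f x| <= M) ->
    (\int[P]_w f (\row_k X r (v k) w)) @[r --> 0^'+] -->
    (\int[P']_w f (\row_k Y (v k) w)).

Definition tangent_process {R : realType}
    {d : measure_display} {T : measurableType d} (P : probability T R)
    {d' : measure_display} {T' : measurableType d'} (P' : probability T' R)
    (X : R -> {RV P >-> R}) (h u : R) (Y : R -> {RV P' >-> R}) : Prop :=
  nontrivial_process Y /\
  fdd_cvg P P' (fun r v w => (X (u + r * v) w - X u w) / r `^ h)
               (fun v w => Y v w).

Definition localisable {R : realType}
    {d : measure_display} {T : measurableType d} (P : probability T R)
    (X : R -> {RV P >-> R}) (h u : R) : Prop :=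
  0 < h /\
  exists (d' : measure_display) (T' : measurableType d')
         (P' : probability T' R) (Y : R -> {RV P' >-> R}),
    tangent_process X h u Y.

(* Main.v *)
Require Import Defs.
From HB Require Import structures.
From mathcomp Require Import all_boot all_order all_algebra.
From mathcomp Require Import complex.
From mathcomp Require Import all_classical all_reals all_analysis.
From mathcomp Require Import measurable_realfun ring lra.
Import Order.TTheory GRing.Theory Num.Theory.
Import numFieldNormedType.Exports.
Local Open Scope classical_set_scope.
Local Open Scope ring_scope.

(** Substituting x = u + r y turns the characteristic function of the rescaled
    increments of X at u into exp (- int |sum_k theta_k g_r(v_k, y)|^alpha(u + r y) dy),
    where g_r is the kernel of the motion with tempering parameter lambda r. As
    r tends to 0 the integrand converges to that of the tangent process, and it
    is dominated by a multiple of 1_[-2V, V](y) + 1_(y <= -1) (-y)^(H - 2); here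
    1/a < H < 1 forces a > 1. On the other side, the characteristic function of a
    simple stable integral comes from the independence of Z on the atoms of the
    sets involved, and the general case follows by approximation in L^p.
    Convergence of characteristic functions gives convergence of the
    finite-dimensional distributions because trigonometric polynomials (Bernstein
    polynomials in sin (q x_k)) approximate bounded continuous functions on large
    boxes, uniformly bounded outside, and because 1 - E cos (t X) <= C t makes the
    rescaled increments tight. *)

(** The varying exponent leaves no defect in the scaling. At x = u + r y the increment of the kernel
    carries the factor r^(H - 1/alpha(x)); after division by r^H and raising to the power alpha(x)
    exactly r^(-1) is left, whatever alpha(x) is, and this cancels the Jacobian of the substitution.
    What then remains is the pointwise passage alpha(u + r y) -> alpha(u) under a bound uniform in
    the exponent. Because a > 1, all exponents H - 1/alpha(x) lie in (0, 1), so that the kernels are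
    continuous where their powers vanish, and Minkowski's inequality is available for the stable
    integrals. All laws involved are symmetric: a characteristic function amounts to a cosine
    expectation together with a sine expectation equal to 0, and the arguments run on these two real
    integrals. As X and Y may live on different probability spaces, only such expectations are ever
    compared. *)

(** * Expectations of bounded measurable functions *)

Section bounded_expectation.
Set Implicit Arguments.
Unset Strict Implicit.
Context {R : realType} {d : measure_display} {T : measurableType d}
  (P : probability T R).
Implicit Types f g : T -> R.

(** A class of integrands closed under sums and products, on which integrability under [P] is
    automatic. *)
Definition bmeas f : Prop :=
  measurable_fun [set: T] f /\ exists M : R, forall w, `|f w| <= M.

Lemma bmeas_integrable f : bmeas f -> P.-integrable [set: T] (EFin \o f).
Proof.
move=> [mf [M fM]]; apply: measurable_bounded_integrable => //.
  by rewrite (le_lt_trans (probability_le1 _ _))// ltry.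
exists M; split; first exact: num_real.
by move=> x Mx w _; exact: le_trans (fM w) (ltW Mx).
Qed.

Lemma bmeas_cst c : bmeas (fun=> c).
Proof. by split; [exact: measurable_cst|exists `|c|]. Qed.

Lemma bmeasD f g : bmeas f -> bmeas g -> bmeas (fun w => f w + g w).
Proof.
move=> [mf [M fM]] [mg [N gN]]; split; first exact: measurable_funD.
by exists (M + N) => w; rewrite (le_trans (ler_normD _ _))// lerD.
Qed.

Lemma bmeasM f g : bmeas f -> bmeas g -> bmeas (fun w => f w * g w).
Proof.
move=> [mf [M fM]] [mg [N gN]]; split; first exact: measurable_funM.
by exists (M * N) => w; rewrite normrM ler_pM.
Qed.

Lemma bmeasZ c f : bmeas f -> bmeas (fun w => c * f w).
Proof. by apply: bmeasM; exact: bmeas_cst. Qed.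

Lemma bmeasN f : bmeas f -> bmeas (fun w => - f w).
Proof. by move=> /(bmeasZ (-1)); under eq_fun do rewrite mulN1r. Qed.

Lemma bmeasB f g : bmeas f -> bmeas g -> bmeas (fun w => f w - g w).
Proof. by move=> bf bg; apply: bmeasD => //; exact: bmeasN. Qed.

Lemma bmeas_norm f : bmeas f -> bmeas (fun w => `|f w|).
Proof.
move=> [mf [M fM]]; split; first exact: measurableT_comp.
by exists M => w; rewrite normr_id.
Qed.

Lemma bmeas_sum (I : Type) (s : seq I) (F : I -> T -> R) :
  (forall i, bmeas (F i)) -> bmeas (fun w => \sum_(i <- s) F i w).
Proof.
move=> bF; elim: s => [|i s IH].
  by under eq_fun do rewrite big_nil; exact: bmeas_cst.
by under eq_fun do rewrite big_cons; exact: bmeasD.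
Qed.

Lemma bmeas_prod (I : Type) (s : seq I) (F : I -> T -> R) :
  (forall i, bmeas (F i)) -> bmeas (fun w => \prod_(i <- s) F i w).
Proof.
move=> bF; elim: s => [|i s IH].
  by under eq_fun do rewrite big_nil; exact: bmeas_cst.
by under eq_fun do rewrite big_cons; exact: bmeasM.
Qed.

Lemma bmeas_indic (A : set T) : measurable A -> bmeas (\1_A : T -> R).
Proof.
move=> mA; split; first exact: measurable_indic.
by exists 1 => w; rewrite indicE; case: (_ \in _); rewrite ?normr1 ?normr0.
Qed.

Lemma bmeas_comp (h : R -> R) (M : R) f : measurable_fun [set: R] h ->
  (forall x, `|h x| <= M) -> measurable_fun [set: T] f ->
  bmeas (fun w => h (f w)).
Proof.
by move=> mh hM mf; split; [exact: measurableT_comp mh mf|exists M => w].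
Qed.

Lemma bmeas_cos f : measurable_fun [set: T] f -> bmeas (fun w => cos (f w)).
Proof.
apply: (@bmeas_comp _ 1); last exact: cos_max.
by apply: continuous_measurable_fun; exact: continuous_cos.
Qed.

Lemma bmeas_sin f : measurable_fun [set: T] f -> bmeas (fun w => sin (f w)).
Proof.
apply: (@bmeas_comp _ 1); last exact: sin_max.
by apply: continuous_measurable_fun; exact: continuous_sin.
Qed.

Lemma expect_add f g : bmeas f -> bmeas g ->
  \int[P]_w (f w + g w) = \int[P]_w f w + \int[P]_w g w.
Proof. by move=> bf bg; rewrite RintegralD//; exact: bmeas_integrable. Qed.

Lemma expect_scale c f : bmeas f ->
  \int[P]_w (c * f w) = c * \int[P]_w f w.
Proof. by move=> bf; rewrite RintegralZl//; exact: bmeas_integrable. Qed.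

Lemma expect_sub f g : bmeas f -> bmeas g ->
  \int[P]_w (f w - g w) = \int[P]_w f w - \int[P]_w g w.
Proof. by move=> bf bg; rewrite RintegralB//; exact: bmeas_integrable. Qed.

Lemma expect_sum (I : Type) (s : seq I) (F : I -> T -> R) :
  (forall i, bmeas (F i)) ->
  \int[P]_w (\sum_(i <- s) F i w) = \sum_(i <- s) \int[P]_w F i w.
Proof.
move=> bF; elim: s => [|i s IH].
  rewrite big_nil; under eq_Rintegral do rewrite big_nil.
  by rewrite Rintegral_cst// mul0r.
rewrite big_cons; under eq_Rintegral do rewrite big_cons.
by rewrite expect_add ?IH//; exact: bmeas_sum.
Qed.

Lemma expect_cst c : \int[P]_w c = c.
Proof. by rewrite Rintegral_cst// [X in fine X](_ : _ = 1%E) ?mulr1//; exact: (probability_setT P). Qed.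

Lemma expect_le f g : bmeas f -> bmeas g -> (forall w, f w <= g w) ->
  \int[P]_w f w <= \int[P]_w g w.
Proof.
by move=> bf bg fg; apply: le_Rintegral => //; exact: bmeas_integrable.
Qed.

Lemma expect_norm f : bmeas f -> `|\int[P]_w f w| <= \int[P]_w `|f w|.
Proof. by move=> bf; apply: le_normr_Rintegral => //; exact: bmeas_integrable. Qed.

Lemma expect_dist f g h : bmeas f -> bmeas g -> bmeas h ->
  (forall w, `|f w - g w| <= h w) ->
  `|\int[P]_w f w - \int[P]_w g w| <= \int[P]_w h w.
Proof.
move=> bf bg bh fgh; rewrite -expect_sub// (le_trans (expect_norm _))//.
  exact: bmeasB.
by apply: expect_le => //; apply/bmeas_norm/bmeasB.
Qed.

Lemma expect_indic (A : set T) : measurable A ->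
  \int[P]_w \1_A w = fine (P A).
Proof. by move=> mA; rewrite /Rintegral integral_indic// setIT. Qed.

End bounded_expectation.

(** * Bernstein polynomials in several variables *)

Section bernstein.
Set Implicit Arguments.
Unset Strict Implicit.
Context {R : realType}.
Implicit Types (z : R) (N j : nat) (g : nat -> R).

Definition bernstein_weight z N j : R :=
  z ^+ j * (1 - z) ^+ (N - j) *+ 'C(N, j).

Lemma bernstein_weight_ge0 z N j : 0 <= z <= 1 -> 0 <= bernstein_weight z N j.
Proof.
move=> /andP[z0 z1]; apply: mulrn_wge0.
by rewrite mulr_ge0 ?exprn_ge0 ?subr_ge0.
Qed.

(** The weights are the binomial law with parameters N and z; conditioning on one of N + 1 trials is
    Pascal's rule. Total mass, mean and variance follow from it by induction on N. *)
Lemma bernstein_weight_rec z N g :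
  \sum_(j < N.+2) bernstein_weight z N.+1 j * g j =
  z * (\sum_(j < N.+1) bernstein_weight z N j * g j.+1) +
  (1 - z) * \sum_(j < N.+1) bernstein_weight z N j * g j.
Proof.
rewrite [RHS]addrC big_ord_recl [in RHS]big_ord_recl [in RHS]mulrDr -addrA; congr (_ + _).
  by rewrite /bernstein_weight !bin0 !expr0 !mul1r !subn0 exprS !mulr1n mulrA.
under eq_bigr => i _ do rewrite /bernstein_weight lift0 subSS binS mulrnDr mulrDl.
rewrite big_split/= addrC [RHS]addrC; congr (_ + _).
  rewrite mulr_sumr; apply: eq_bigr => i _; rewrite /bernstein_weight.
  by rewrite exprS !mulrnAl !mulrnAr !mulrA.
(* The top index contributes nothing, as 'C(N, N + 1) = 0. *)
rewrite big_ord_recr/= bin_small// mulr0n mul0r addr0 mulr_sumr.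
apply: eq_bigr => i _; rewrite /bernstein_weight [bump 0 i]/bump leq0n add1n.
have -> : (N - i = (N - i.+1).+1)%N by rewrite subnSK.
by rewrite [(1 - z) ^+ _.+1]exprS !mulrnAl !mulrnAr; congr (_ *+ _); ring.
Qed.

Lemma bernstein_weight_sum z N : \sum_(j < N.+1) bernstein_weight z N j = 1.
Proof.
elim: N => [|N IH].
  by rewrite big_ord_recl big_ord0 /bernstein_weight bin0 !expr0 mulr1 mulr1n addr0.
have := bernstein_weight_rec z N (fun=> 1).
under eq_bigr do rewrite mulr1; move=> ->.
by under eq_bigr do rewrite mulr1; rewrite IH !mulr1 addrC subrK.
Qed.

Lemma bernstein_weight_mean z N :
  \sum_(j < N.+1) bernstein_weight z N j * j%:R = N%:R * z.
Proof.
elim: N => [|N IH].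
  by rewrite big_ord_recl big_ord0 mulr0 addr0 mul0r.
rewrite (bernstein_weight_rec z N (fun j => j%:R)) IH.
under eq_bigr do rewrite -natr1 mulrDr mulr1.
by rewrite big_split/= IH bernstein_weight_sum -natr1; ring.
Qed.

Lemma bernstein_weight_variance z N :
  \sum_(j < N.+1) bernstein_weight z N j * (j%:R - N%:R * z) ^+ 2 =
  N%:R * (z * (1 - z)).
Proof.
have m2 : \sum_(j < N.+1) bernstein_weight z N j * j%:R ^+ 2 =
    N%:R * (z * (1 - z)) + (N%:R * z) ^+ 2.
  elim: N => [|N IH].
    by rewrite big_ord_recl big_ord0 expr0n mulr0 addr0 !mul0r expr0n addr0.
  rewrite (bernstein_weight_rec z N (fun j => j%:R ^+ 2)) IH.
  have sq (j : 'I_N.+1) : bernstein_weight z N j * j.+1%:R ^+ 2 =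
      bernstein_weight z N j * j%:R ^+ 2 +
      (2 * (bernstein_weight z N j * j%:R) + bernstein_weight z N j).
    by rewrite -natr1; ring.
  under eq_bigr do rewrite sq.
  rewrite !big_split/= -mulr_sumr IH bernstein_weight_sum bernstein_weight_mean.
  by rewrite -natr1; ring.
have sq (j : 'I_N.+1) : bernstein_weight z N j * (j%:R - N%:R * z) ^+ 2 =
    bernstein_weight z N j * j%:R ^+ 2 +
    (- (2 * (N%:R * z)) * (bernstein_weight z N j * j%:R) +
     (N%:R * z) ^+ 2 * bernstein_weight z N j) by ring.
under eq_bigr do rewrite sq.
rewrite !big_split/= -!mulr_sumr m2 bernstein_weight_mean bernstein_weight_sum.
by ring.
Qed.

Variable n : nat.
Implicit Types (f : ('I_n -> R) -> R) (x y : 'I_n -> R).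

(** The expectation of f at (S_k / N)_k for independent binomial variables S_k with parameters N and
    x_k. *)
Definition bernstein f N x : R :=
  \sum_(kappa : {ffun 'I_n -> 'I_N.+1})
    (\prod_k bernstein_weight (x k) N (kappa k)) *
    f (fun k => (kappa k)%:R / N%:R).

(** Distributing the product over the sum, each coordinate other than k sums to 1. *)
Lemma bernstein_marginal N x (k : 'I_n) g :
  \sum_(kappa : {ffun 'I_n -> 'I_N.+1})
    (\prod_i bernstein_weight (x i) N (kappa i)) * g (kappa k) =
  \sum_(j < N.+1) bernstein_weight (x k) N j * g j.
Proof.
pose F i (j : 'I_N.+1) := bernstein_weight (x i) N j * (if i == k then g j else 1).
transitivity (\prod_i \sum_j F i j).
  rewrite bigA_distr_bigA; apply: eq_bigr => kappa _.
  by rewrite /F big_split/= -big_mkcond/= big_pred1_eq.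
rewrite (bigD1 k)//= [X in _ * X]big1 ?mulr1.
  by apply: eq_bigr => j _; rewrite /F eqxx.
move=> i /negbTE ik; rewrite /F ik.
by under eq_bigr do rewrite mulr1; rewrite bernstein_weight_sum.
Qed.

Lemma bernstein_sum N x :
  \sum_(kappa : {ffun 'I_n -> 'I_N.+1})
    \prod_i bernstein_weight (x i) N (kappa i) = 1.
Proof.
rewrite -(bigA_distr_bigA (fun i (j : 'I_N.+1) => bernstein_weight (x i) N j)).
by rewrite big1// => i _; exact: bernstein_weight_sum.
Qed.

(** The polynomial is an average of values of f. This is what keeps the trigonometric approximants
    bounded by M far away from the box where they are accurate. *)
Lemma bernstein_bound f (M : R) N x : (forall k, 0 <= x k <= 1) ->
  (forall y, `|f y| <= M) -> `|bernstein f N x| <= M.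
Proof.
move=> x01 fM; rewrite (le_trans (ler_norm_sum _ _ _))//.
rewrite -[leRHS]mul1r -[in leRHS](bernstein_sum N x) mulr_suml; apply: ler_sum => kappa _.
have p0 : 0 <= \prod_k bernstein_weight (x k) N (kappa k).
  by apply: prodr_ge0 => i _; exact: bernstein_weight_ge0.
by rewrite normrM (ger0_norm p0) ler_wpM2l.
Qed.

(* Chebyshev: the multinodes far from x carry a mass at most n / (4 N delta^2). *)
Lemma bernstein_dist f (M e delta : R) N x : (0 < N)%N -> 0 < delta ->
  (forall k, 0 <= x k <= 1) -> (forall y, `|f y| <= M) ->
  (forall y, (forall k, 0 <= y k <= 1) -> (forall k, `|x k - y k| < delta) ->
    `|f x - f y| <= e) -> 0 <= e ->
  `|f x - bernstein f N x| <= e + 2 * M / delta ^+ 2 * (n%:R / N%:R).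
Proof.
move=> N0 delta0 x01 fM fe e0; have N0' : 0 < N%:R :> R by rewrite ltr0n.
have M0 : 0 <= M by rewrite (le_trans (normr_ge0 _) (fM (fun=> 0))).
pose W (kappa : {ffun 'I_n -> 'I_N.+1}) :=
  \prod_k bernstein_weight (x k) N (kappa k).
have W0 kappa : 0 <= W kappa.
  by apply: prodr_ge0 => i _; exact: bernstein_weight_ge0.
pose K := 2 * M / delta ^+ 2.
have K0 : 0 <= K by apply: divr_ge0; [exact: mulr_ge0|exact: sqr_ge0].
(* A near node costs e. At a far node some coordinate is off by at least delta, so the trivial bound
   2 M is at most K times the sum of squares. *)
have step (kappa : {ffun 'I_n -> 'I_N.+1}) : `|f x - f (fun k => (kappa k)%:R / N%:R)| <=
    e + K * \sum_k ((kappa k)%:R / N%:R - x k) ^+ 2.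
  have S0 : 0 <= \sum_k ((kappa k)%:R / N%:R - x k) ^+ 2.
    by apply: sumr_ge0 => k _; exact: sqr_ge0.
  have [near|] := pselect (forall k, `|x k - (kappa k)%:R / N%:R| < delta).
    have KS : 0 <= K * \sum_k ((kappa k)%:R / N%:R - x k) ^+ 2 by exact: mulr_ge0.
    rewrite (le_trans (fe _ _ near)) ?lerDl// => k.
    rewrite divr_ge0 ?ler0n//= ler_pdivrMr// mul1r ler_nat.
    by have := ltn_ord (kappa k).
  move=> /existsNP[k /negP]; rewrite -leNgt => far.
  rewrite (le_trans (ler_normB _ _))//.
  rewrite (@le_trans _ _ (2 * M))//; first by rewrite mulr2n mulrDl !mul1r lerD.
  rewrite -[leLHS]add0r lerD// -[leLHS](@divfK _ (delta ^+ 2)); last first.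
    by rewrite expf_neq0// gt_eqF.
  rewrite -/K ler_wpM2l// (bigD1 k)//= (@le_trans _ _ (((kappa k)%:R / N%:R - x k) ^+ 2))//.
    by rewrite -[leRHS]real_normK ?num_real// distrC lerXn2r ?nnegrE// ltW.
  by rewrite lerDl; apply: sumr_ge0 => i _; exact: sqr_ge0.
have -> : f x - bernstein f N x =
    \sum_kappa W kappa * (f x - f (fun k => (kappa k)%:R / N%:R)).
  under eq_bigr do rewrite mulrBr.
  by rewrite sumrB -mulr_suml bernstein_sum mul1r.
rewrite (le_trans (ler_norm_sum _ _ _))//.
under eq_bigr do rewrite normrM ger0_norm//.
rewrite (@le_trans _ _ (\sum_kappa W kappa *
    (e + K * \sum_k ((kappa k)%:R / N%:R - x k) ^+ 2)))//.
  by apply: ler_sum => kappa _; rewrite ler_wpM2l.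
under eq_bigr do rewrite mulrDr.
rewrite big_split/= -mulr_suml bernstein_sum mul1r lerD2l.
under eq_bigr do rewrite mulrCA.
rewrite -mulr_sumr ler_wpM2l//.
under eq_bigr do rewrite mulr_sumr.
rewrite exchange_big/= (_ : n%:R / N%:R = \sum_(k < n) N%:R^-1); last first.
  by rewrite sumr_const card_ord mulr_natl.
apply: ler_sum => k _.
rewrite (bernstein_marginal _ _ _ (fun j => (j%:R / N%:R - x k) ^+ 2)).
have -> : \sum_(j < N.+1) bernstein_weight (x k) N j * (j%:R / N%:R - x k) ^+ 2 =
    (N%:R ^+ 2)^-1 *
    \sum_(j < N.+1) bernstein_weight (x k) N j * (j%:R - N%:R * x k) ^+ 2.
  rewrite mulr_sumr; apply: eq_bigr => j _.
  by field; rewrite gt_eqF.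
rewrite bernstein_weight_variance (_ : _ * _ = N%:R^-1 * (x k * (1 - x k))).
  (* The crude bound x (1 - x) <= 1 is used here, hence n / N in the statement. *)
  have /andP[xk0 xk1] := x01 k.
  rewrite -[leRHS]mulr1 ler_wpM2l ?invr_ge0 ?ler0n//.
  by rewrite mulr_ile1 ?subr_ge0// lerBlDr lerDl.
by field; rewrite gt_eqF.
Qed.

End bernstein.

(** * Uniform continuity near compact sets *)

Section uniform_continuity.
Set Implicit Arguments.
Unset Strict Implicit.
Context {R : realType}.

(** A form of the Heine-Cantor theorem in which only x is confined to K; y may leave it. *)
Lemma compact_uniform_modulus (X : pseudoMetricType R) (K : set X) (f : X -> R) :
  compact K -> continuous f -> forall e : R, 0 < e ->
  exists2 delta : R, 0 < delta &
    forall x y, K x -> ball x delta y -> `|f x - f y| < e.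
Proof.
move=> cK cf e e0.
have /compact_near_coveringP cover := cK.
have H : \forall delta \near 0^'+,
    K `<=` (fun x => forall y, ball x delta y -> `|f x - f y| < e).
  apply: cover => x Kx.
  have /cvgrPdist_lt/(_ (e / 2)) := cf x; rewrite divr_gt0// => /(_ isT).
  move=> /nbhs_ballP[r /= r0 fr].
  (* With x' within r / 2 of x and y within delta < r / 2 of x', both x' and y fall in the ball of
     radius r around x. *)
  exists (ball x (r / 2), [set delta : R | 0 < delta < r / 2]).
    split => /=; first by apply: nbhsx_ballx; rewrite divr_gt0.
    exists (r / 2) => /=; first by rewrite divr_gt0.
    by move=> t /=; rewrite sub0r normrN => /ltr_normlW -> ->.
  move=> [x' delta] [/= xx' /andP[delta0 deltar]] y x'y.
  have /fr fx' : ball x r x' by apply: le_ball xx'; rewrite ler_pdivrMr// ler_peMr ?ler1n// ltW.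
  have /fr fy : ball x r y by apply: ball_split xx' _; apply: le_ball x'y; exact: ltW.
  rewrite (splitr e) -(subrK (f x) (f x')) -addrA (le_lt_trans (ler_normD _ _))//.
  by rewrite ltrD// distrC.
near (0 : R)^'+ => delta; exists delta.
  by near: delta; exact: nbhs_right_gt.
move=> x y Kx; move: x Kx y.
by near: delta.
Unshelve. all: by end_near. Qed.

Lemma row_uniform_modulus n (f : 'rV[R]_n -> R) : continuous f ->
  forall B e : R, 0 < e -> exists2 delta : R, 0 < delta &
    forall x y : 'I_n -> R, (forall k, `|x k| <= B) ->
      (forall k, `|x k - y k| < delta) ->
      `|f (\row_k x k) - f (\row_k y k)| < e.
Proof.
move=> cf B e e0.
have cB : compact [set v : 'rV[R]_n | forall i, `[- B, B]%classic (v ord0 i)].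
  by apply: (@rV_compact R n (fun=> `[- B, B]%classic)) => i; exact: segment_compact.
have [delta delta0 H] := compact_uniform_modulus cB cf e0.
exists delta => // x y xB xy; apply: H => /=.
  by move=> i; rewrite mxE /= in_itv/= -ler_norml.
by split => // i j; rewrite !mxE; exact: xy.
Qed.

End uniform_continuity.

(** * Trigonometric polynomials and uniform approximation on boxes *)

Section trigonometric_polynomials.
Set Implicit Arguments.
Unset Strict Implicit.
Context {R : realType} (n : nat).
Implicit Types (theta x : 'I_n -> R) (g h : ('I_n -> R) -> R).

(** Only linear combinations are constructors, so that convergence of expectations follows by
    induction from cosines and sines; stability under products is derived afterwards. *)
Inductive trigpoly : (('I_n -> R) -> R) -> Prop :=
| trigpoly_cos theta : trigpoly (fun x => cos (\sum_k theta k * x k))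
| trigpoly_sin theta : trigpoly (fun x => sin (\sum_k theta k * x k))
| trigpolyD g h : trigpoly g -> trigpoly h -> trigpoly (fun x => g x + h x)
| trigpolyZ (c : R) g : trigpoly g -> trigpoly (fun x => c * g x).

Lemma trigpoly_eq g h : g =1 h -> trigpoly g -> trigpoly h.
Proof. by move=> /funext ->. Qed.

Lemma trigpoly_cst c : trigpoly (fun=> c).
Proof.
apply: trigpoly_eq (trigpolyZ c (trigpoly_cos (fun=> 0))) => x.
by rewrite big1 ?cos0 ?mulr1// => k _; rewrite mul0r.
Qed.

Let cos_sum theta theta' x :
  \sum_k (theta k + theta' k) * x k = \sum_k theta k * x k + \sum_k theta' k * x k.
Proof. by rewrite -big_split; apply: eq_bigr => k _; rewrite mulrDl. Qed.

Let cos_dif theta theta' x :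
  \sum_k (theta k - theta' k) * x k = \sum_k theta k * x k - \sum_k theta' k * x k.
Proof. by rewrite -sumrB; apply: eq_bigr => k _; rewrite mulrBl. Qed.

(** The product-to-sum formulas settle generators, and bilinearity does the rest by an induction on
    each factor. *)
Lemma trigpolyM g h : trigpoly g -> trigpoly h -> trigpoly (fun x => g x * h x).
Proof.
(* The constant c is the sign, 1 or -1, in the product-to-sum formula. *)
have halve (p q : ('I_n -> R) -> R) (c : R) : trigpoly p -> trigpoly q ->
    trigpoly (fun x => 2^-1 * p x + c / 2 * q x).
  by move=> tp tq; apply: trigpolyD; exact: trigpolyZ.
have mulcos theta h' : trigpoly h' ->
    trigpoly (fun x => cos (\sum_k theta k * x k) * h' x) /\
    trigpoly (fun x => sin (\sum_k theta k * x k) * h' x).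
  elim=> {h'} [th|th|h1 h2 _ [c1 s1] _ [c2 s2]|c h1 _ [c1 s1]].
  - split.
      apply: trigpoly_eq (halve _ _ 1
        (trigpoly_cos (fun k => theta k + th k)) (trigpoly_cos (fun k => theta k - th k))) => x.
      by rewrite /= cos_dif cos_sum cosB cosD; field.
    apply: trigpoly_eq (halve _ _ 1
      (trigpoly_sin (fun k => theta k + th k)) (trigpoly_sin (fun k => theta k - th k))) => x.
    by rewrite /= cos_dif cos_sum sinB sinD; field.
  - split.
      apply: trigpoly_eq (halve _ _ (-1)
        (trigpoly_sin (fun k => theta k + th k)) (trigpoly_sin (fun k => theta k - th k))) => x.
      by rewrite /= cos_dif cos_sum sinB sinD; field.
    apply: trigpoly_eq (halve _ _ (-1)
      (trigpoly_cos (fun k => theta k - th k)) (trigpoly_cos (fun k => theta k + th k))) => x.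
    by rewrite /= cos_dif cos_sum cosB cosD; field.
  - split; [apply: trigpoly_eq (trigpolyD c1 c2)|apply: trigpoly_eq (trigpolyD s1 s2)];
      by move=> x; rewrite mulrDr.
  - split; [apply: trigpoly_eq (trigpolyZ c c1)|apply: trigpoly_eq (trigpolyZ c s1)];
      by move=> x; rewrite mulrCA.
elim=> {g} [th|th|g1 g2 _ IH1 _ IH2|c g _ IH] th'.
- exact: (mulcos th h th').1.
- exact: (mulcos th h th').2.
- apply: trigpoly_eq (trigpolyD (IH1 th') (IH2 th')) => x.
  by rewrite mulrDl.
- by apply: trigpoly_eq (trigpolyZ c (IH th')) => x; rewrite mulrA.
Qed.

Lemma trigpolyX g m : trigpoly g -> trigpoly (fun x => g x ^+ m).
Proof.
move=> tg; elim: m => [|m IH].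
  by under eq_fun do rewrite expr0; exact: trigpoly_cst.
by under eq_fun do rewrite exprS; exact: trigpolyM.
Qed.

Lemma trigpoly_sum (I : Type) (s : seq I) (F : I -> ('I_n -> R) -> R) :
  (forall i, trigpoly (F i)) -> trigpoly (fun x => \sum_(i <- s) F i x).
Proof.
move=> tF; elim: s => [|i s IH].
  by under eq_fun do rewrite big_nil; exact: trigpoly_cst.
by under eq_fun do rewrite big_cons; exact: trigpolyD.
Qed.

Lemma trigpoly_prod (I : Type) (s : seq I) (F : I -> ('I_n -> R) -> R) :
  (forall i, trigpoly (F i)) -> trigpoly (fun x => \prod_(i <- s) F i x).
Proof.
move=> tF; elim: s => [|i s IH].
  by under eq_fun do rewrite big_nil; exact: trigpoly_cst.
by under eq_fun do rewrite big_cons; exact: trigpolyM.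
Qed.

Lemma trigpoly_coord (q : R) (k : 'I_n) : trigpoly (fun x => sin (q * x k)).
Proof.
apply: trigpoly_eq (trigpoly_sin (fun i => if i == k then q else 0)) => x.
rewrite (bigD1 k)//= eqxx big1 ?addr0// => i /negbTE ->.
by rewrite mul0r.
Qed.

Lemma trigpoly_bernstein (f : ('I_n -> R) -> R) (N : nat) (q : R) :
  trigpoly (fun x => bernstein f N (fun k => (1 + sin (q * x k)) / 2)).
Proof.
apply: trigpoly_sum => kappa; apply: trigpolyM; last exact: trigpoly_cst.
apply: trigpoly_prod => k; rewrite /bernstein_weight.
have aff (c : R) : trigpoly (fun x => c * (1 + sin (q * x k))).
  by apply/trigpolyZ/trigpolyD; [exact: trigpoly_cst|exact: trigpoly_coord].
have tk : trigpoly (fun x => (1 + sin (q * x k)) / 2).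
  by apply: trigpoly_eq (aff 2^-1) => x; rewrite mulrC.
have tk' : trigpoly (fun x => 1 - (1 + sin (q * x k)) / 2).
  by apply: trigpoly_eq (trigpolyD (trigpoly_cst 1) (aff (- 2^-1))) => x;
    rewrite mulNr mulrC.
apply: trigpoly_eq (trigpolyZ ('C(N, kappa k)%:R)
  (trigpolyM (trigpolyX (kappa k) tk) (trigpolyX (N - kappa k) tk'))) => x.
by rewrite mulr_natl.
Qed.

Lemma maxr_dist_le (a t s : R) : `|Num.max a t - Num.max a s| <= `|t - s|.
Proof.
have := ler_norm (t - s); have := ler_norm (s - t); rewrite distrC => D1 D2.
rewrite !maxEle ler_norml; case: (leP a t) => ?; case: (leP a s) => ?;
  apply/andP; split; lra.
Qed.

(* On [-L, L] the substitution t = sin (pi x / (4 L)) is invertible, so that a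
   Bernstein polynomial in the t_k is a trigonometric polynomial close to f
   there, and it keeps the bound M on the whole space. *)
Lemma trigpoly_approx (f : 'rV[R]_n -> R) (M L e : R) : continuous f ->
  (forall v, `|f v| <= M) -> 0 < L -> 0 < e ->
  exists h, [/\ trigpoly h, forall x, `|h x| <= M &
    forall x, (forall k, `|x k| <= L) -> `|f (\row_k x k) - h x| <= e].
Proof.
move=> cf fM L0 e0.
have pi4 : 0 < pi / 4 :> R by rewrite divr_gt0// pi_gt0.
have pi42 : pi / 4 < pi / 2 :> R.
  by rewrite ltr_pM2l ?pi_gt0// ltf_pV2 ?posrE// ltr_nat.
pose c : R := sin (pi / 4).
have c1 : c < 1.
  have p0 := pi_gt0 R.
  by rewrite -sin_pihalf ltr_sin// in_itv/=; apply/andP; split; lra.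
have c0 : 0 < c.
  have p0 := pi_gt0 R.
  by rewrite sin_gt0_pi//; apply/andP; split; lra.
(* Truncation to [-c, c] with c = sin (pi / 4) < 1 keeps the argument of [asin] inside (-1, 1), so
   that [phi] is continuous and bounded on the whole line. *)
pose clip t : R := Num.max (- c) (Num.min c t).
have clip1 t : -1 < clip t < 1.
  rewrite /clip lt_max ltrN2 c1/= gt_max gt_min c1/= andbT.
  by rewrite ltrNl (lt_trans _ c0)// oppr_lt0.
(* Then |x_k| <= L gives |q x_k| <= pi / 4: the truncation is inactive and [asin] inverts [sin]
   there. *)
pose q : R := pi / 4 / L.
have q0 : 0 < q by rewrite divr_gt0.
pose phi t : R := asin (clip t) / q.
have cphi : continuous phi.
  move=> t; apply: cvgMl.
  apply: (@continuous_comp _ _ _ clip asin); last exact: continuous_asin.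
  apply/cvgrPdist_lt => r r0; near=> s.
  apply: (@le_lt_trans _ _ `|t - s|); last by near: s; exact: cvgr_dist_lt.
  rewrite (le_trans (maxr_dist_le _ _ _))// -normrN opprD !oppr_min.
  by rewrite (le_trans (maxr_dist_le _ _ _))// -opprD normrN.
have phiB t : `|phi t| <= pi / 2 / q.
  have /andP[t0 t1] := clip1 t.
  rewrite normrM (gtr0_norm (x := q^-1)) ?invr_gt0// ler_pM2r ?invr_gt0//.
  by rewrite ler_norml asin_geNpi2 ?asin_lepi2 ?ltW.
(* The variable z = (1 + t) / 2 brings t in [-1, 1] to the unit interval required by Bernstein
   polynomials. *)
pose F (z : 'I_n -> R) := f (\row_k phi (2 * z k - 1)).
have [d2 d20 Hf] := row_uniform_modulus cf (pi / 2 / q) (divr_gt0 e0 (ltr0n _ 2)).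
have [d1 d10 Hphi] := compact_uniform_modulus (@segment_compact R (-1) 1) cphi d20.
(* The radius is d1 / 2 because z -> 2 z - 1 doubles distances; N makes the Chebyshev term at most e
   / 2. *)
have [N N0] : exists2 N : nat, (0 < N)%N &
    2 * M / (d1 / 2) ^+ 2 * (n%:R / N%:R) <= e / 2.
  set K := 2 * M / _; exists (Num.truncn (K * n%:R / (e / 2))).+1 => //.
  rewrite mulrA ler_pdivrMr ?ltr0n// -ler_pdivrMl ?divr_gt0// mulrC.
  exact/ltW/truncnS_gt.
move=> HN; exists (fun x => bernstein F N (fun k => (1 + sin (q * x k)) / 2)).
have z01 x (k : 'I_n) : 0 <= (1 + sin (q * x k)) / 2 <= 1.
  have /andP[s0 s1] : -1 <= sin (q * x k) <= 1 by rewrite sin_geN1 sin_le1.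
  by apply/andP; split; lra.
split; first exact: trigpoly_bernstein.
  by move=> x; apply: bernstein_bound => // y; exact: fM.
move=> x xL.
pose z k := (1 + sin (q * x k)) / 2.
have -> : f (\row_k x k) = F z.
  rewrite /F; congr f; apply/rowP => k; rewrite !mxE.
  have -> : 2 * z k - 1 = sin (q * x k) by rewrite /z; field.
  have qx : - (pi / 4) <= q * x k <= pi / 4.
    rewrite -ler_norml normrM gtr0_norm// -ler_pdivlMl//.
    have -> : q^-1 * (pi / 4) = L.
      by rewrite /q invf_div divfK// gt_eqF.
    exact: xL.
  have p0 := pi_gt0 R; move: qx => /andP[qx0 qx1].
  have s1 : sin (q * x k) <= c.
    by rewrite /c leNgt ltr_sin -?leNgt// in_itv/=; apply/andP; split; lra.
  have s0 : - c <= sin (q * x k).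
    by rewrite /c -sinN leNgt ltr_sin -?leNgt// in_itv/=; apply/andP; split; lra.
  rewrite /phi /clip (min_idPr s1) (max_idPr s0) sinK; last first.
    by rewrite in_itv/=; apply/andP; split; lra.
  by field; rewrite gt_eqF.
have near_z y : (forall k, 0 <= y k <= 1) -> (forall k, `|z k - y k| < d1 / 2) ->
    `|F z - F y| <= e / 2.
  move=> y01 zy; apply/ltW/Hf => k; first exact: phiB.
  apply: Hphi => /=.
    by rewrite in_itv/=; have /andP[] := z01 x k; rewrite /z => ? ?; apply/andP; split; lra.
  suff : `|2 * z k - 1 - (2 * y k - 1)| < d1 by [].
  rewrite (_ : 2 * z k - 1 - (2 * y k - 1) = 2 * (z k - y k)); last by ring.
  by rewrite normrM ger0_norm// -ltr_pdivlMl// mulrC; exact: zy.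
have FM y : `|F y| <= M by exact: fM.
have d12 : 0 < d1 / 2 by rewrite divr_gt0.
have e2 : 0 <= e / 2 by rewrite divr_ge0// ltW.
rewrite (splitr e).
apply: (le_trans (bernstein_dist N0 d12 (z01 x) FM near_z e2)).
by rewrite lerD2l.
Unshelve. all: by end_near. Qed.

End trigonometric_polynomials.

(** * Tails controlled by the characteristic function near 0 *)

Section tail_bound.
Set Implicit Arguments.
Unset Strict Implicit.
Context {R : realType} {d : measure_display} {T : measurableType d}
  (P : probability T R).

Lemma one_sub_cos_ge (x : R) : 2^-1 <= `|x| <= 1 -> 1 - cos (2^-1) <= 1 - cos x.
Proof.
move=> /andP[x1 x2]; rewrite lerD2l lerN2.
have -> : cos x = cos `|x| by have [//|] := ger0P x; rewrite cosN.
have := pi_ge2 R => p2.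
by rewrite leNgt ltr_cos -?leNgt// in_itv/=; apply/andP; split; lra.
Qed.

Lemma one_sub_cos_gt0 : 0 < 1 - cos (2^-1 : R).
Proof.
have := pi_ge2 R => p2.
by rewrite subr_gt0 -[ltRHS]cos0 ltr_cos// in_itv/=; apply/andP; split; lra.
Qed.

(* The dyadic shell 2^i L < |X| <= 2^(i+1) L is detected by 1 - cos (X / (2^(i+1) L)). *)
Lemma tail_bound (X : T -> R) (C L : R) : measurable_fun [set: T] X ->
  0 <= C -> 1 <= L ->
  (forall t : R, 0 < t <= 1 -> 1 - \int[P]_w cos (t * X w) <= C * t) ->
  fine (P [set w | L < `|X w|]) <= C / (1 - cos (2^-1)) / L.
Proof.
move=> mX C0 L1 HC; have L0 : 0 < L by exact: lt_le_trans L1.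
set c := 1 - cos _; have c0 : 0 < c := one_sub_cos_gt0.
(* Since L >= 1, all these frequencies lie in the range (0, 1] covered by the hypothesis. *)
pose t (i : nat) : R := (2 ^+ i.+1 * L)^-1.
have t0 i : 0 < t i by rewrite invr_gt0 mulr_gt0// exprn_gt0.
have t1 i : 0 < t i <= 1.
  rewrite t0/= invf_le1 ?mulr_gt0 ?exprn_gt0//.
  have E1 : 1 <= 2 ^+ i.+1 :> R by rewrite exprn_ege1// ler1n.
  by rewrite (le_trans L1)// ler_peMl// ltW.
pose A (m : nat) := [set w | L < `|X w| <= 2 ^+ m * L].
have mA m : measurable (A m).
  rewrite (_ : A m = ((fun w => `|X w|) @^-1` `]L, 2 ^+ m * L]%classic)).
    rewrite -[X in measurable X]setTI.
    by apply: (measurableT_comp (@normr_measurable R setT) mX).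
  by apply/seteqP; split => w /=; rewrite in_itv.
have bcos i : @bmeas R d T (fun w => 1 - cos (t i * X w)).
  by apply: bmeasB; [exact: bmeas_cst|apply/bmeas_cos/measurable_funM].
(* A point of [A m] lies in one of the first m shells, whose term alone is at least c; the other
   terms are nonnegative. *)
have ptw m w : c * \1_(A m) w <= \sum_(i < m) (1 - cos (t i * X w)).
  elim: m => [|m IH].
    rewrite big_ord0 indicE memNset ?mulr0// /A /= mul1r.
    by move=> /andP[/lt_le_trans] /[apply]; rewrite ltxx.
  rewrite big_ord_recr/=.
  have pos : 0 <= 1 - cos (t m * X w) by rewrite subr_ge0 cos_le1.
  have [shell|] := boolP (2 ^+ m * L < `|X w| <= 2 ^+ m.+1 * L).
    rewrite (@le_trans _ _ c)//.
      by rewrite ler_piMr ?(ltW c0)// indicE; case: (_ \in _).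
    rewrite -[leLHS]add0r lerD//.
      by apply: sumr_ge0 => i _; rewrite subr_ge0 cos_le1.
    apply: one_sub_cos_ge; rewrite normrM gtr0_norm// mulrC /t.
    move: shell => /andP[s1 s2].
    rewrite ler_pdivrMr ?mulr_gt0 ?exprn_gt0// mul1r s2 andbT.
    rewrite ler_pdivlMr ?mulr_gt0 ?exprn_gt0//.
    by rewrite exprS -mulrA mulKf// ltW.
  move=> shell; rewrite (le_trans _ (lerD IH pos))// addr0.
  rewrite ler_wpM2l ?(ltW c0)// !indicE.
  have [/set_mem/andP[Lw wL]|//] := boolP (w \in A m.+1).
  move: shell; rewrite wL andbT -leNgt => Xm.
  by rewrite [w \in A m]mem_set// /A/= Lw.
have PA m : fine (P (A m)) <= C / c / L.
  rewrite mulrAC ler_pdivlMr// mulrC -expect_indic// -expect_scale; last exact: bmeas_indic.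
  apply: (@le_trans _ _ (\sum_(i < m) \int[P]_w (1 - cos (t i * X w)))).
    rewrite -expect_sum//; apply: expect_le => //.
      by apply/bmeasZ/bmeas_indic.
    exact: bmeas_sum.
  apply: (@le_trans _ _ (\sum_(i < m) C * t i)).
    apply: ler_sum => i _; rewrite expect_sub ?expect_cst ?HC//; first exact: bmeas_cst.
    by apply/bmeas_cos/measurable_funM.
  rewrite -mulr_sumr ler_wpM2l//.
  (* The geometric sum stays below 1 / L, so the bound is uniform in m and survives the passage to
     the union of the [A m]. *)
  suff -> : \sum_(i < m) t i = (1 - (2 ^+ m)^-1) / L.
    rewrite ler_piMl ?invr_ge0 ?(ltW L0)// lerBlDr lerDl invr_ge0 exprn_ge0//.
  elim: m => [|m IH]; first by rewrite big_ord0 expr0 invr1 subrr mul0r.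
  rewrite big_ord_recr/= IH /t exprS; field.
  by rewrite gt_eqF//= expf_neq0.
have cvg : P (A m) @[m --> \oo] --> P (\bigcup_m A m).
  apply: nondecreasing_cvg_mu => //; first exact: bigcup_measurable.
  apply/nondecreasing_seqP => m; rewrite subsetEset => w; rewrite /A/= => /andP[Lw wm].
  by rewrite Lw/= (le_trans wm)// exprS -mulrA ler_peMl ?ler1n// mulr_ge0 ?exprn_ge0 ?ltW.
have -> : [set w | L < `|X w|] = \bigcup_m A m.
  apply/seteqP; split => w /=; last by move=> [m _ /andP[]].
  move=> Lw; exists (Num.truncn (`|X w| / L)).+1 => //; rewrite /A/= Lw/=.
  rewrite -ler_pdivrMr// (le_trans (ltW (truncnS_gt _)))// -natrX ler_nat.
  exact/ltnW/ltn_expl.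
have fin B : measurable B -> P B \is a fin_num by move=> mB; rewrite fin_num_measure.
rewrite -lee_fin fineK; last by apply: fin; exact: bigcup_measurable.
rewrite -(cvg_lim _ cvg)//; apply: lime_le; first by apply/cvg_ex; eexists; exact: cvg.
by apply: nearW => m; rewrite -(fineK (fin _ (mA m))) lee_fin.
Qed.

End tail_bound.

(** * Expectations of test functions compared with trigonometric polynomials *)

Section trigpoly_expectation.
Set Implicit Arguments.
Unset Strict Implicit.
Context {R : realType} {d : measure_display} {T : measurableType d}
  (P : probability T R) {n : nat}.
Variable X : 'I_n -> T -> R.
Hypothesis mX : forall k, measurable_fun [set: T] (X k).

Lemma measurable_linear_comb (theta : 'I_n -> R) :
  measurable_fun [set: T] (fun w => \sum_k theta k * X k w).
Proof. by apply: measurable_sum => k; apply: measurable_funM. Qed.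

Lemma trigpoly_bmeas h : trigpoly h -> bmeas (fun w => h (X ^~ w)).
Proof.
elim=> {h} [theta|theta|g h _ IHg _ IHh|c g _ IH].
- exact/bmeas_cos/measurable_linear_comb.
- exact/bmeas_sin/measurable_linear_comb.
- exact: bmeasD.
- exact: bmeasZ.
Qed.

Variables (f : 'rV[R]_n -> R) (M : R).
Hypothesis cf : continuous f.
Hypothesis fM : forall v, `|f v| <= M.

(** Measurability comes from a pointwise limit: [h m] is within 1 / (m + 1) of f on the box of
    half-side m + 1, which contains any given point for large m. *)
Lemma bmeas_continuous : bmeas (fun w => f (\row_k X k w)).
Proof.
split; last by exists M => w; exact: fM.
have hE m := trigpoly_approx cf fM (ltr0Sn R m) (divr_gt0 ltr01 (ltr0Sn R m)).
pose h m := projT1 (cid (hE m)).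
have hP m : [/\ trigpoly (h m), forall x, `|h m x| <= M &
    forall x, (forall k, `|x k| <= m.+1%:R) -> `|f (\row_k x k) - h m x| <= 1 / m.+1%:R].
  exact: (projT2 (cid (hE m))).
apply: (@measurable_fun_cvg _ _ _ _ (fun m w => h m (X ^~ w))).
  by move=> m; have [th _ _] := hP m; exact: (trigpoly_bmeas th).1.
move=> w _; apply/cvgrPdist_le => e e0; near=> m.
have [_ _ H] := hP m.
apply: le_trans (H (X ^~ w) _) _ => [k|].
  rewrite (@le_trans _ _ m%:R) ?ler_nat//.
  apply: (@le_trans _ _ (\sum_k `|X k w|)).
    by rewrite (bigD1 k)//= lerDl; apply: sumr_ge0.
  near: m; exact: nbhs_infty_ger.
by rewrite div1r ltW//; near: m; exact: (near_infty_natSinv_lt (PosNum e0)).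
Unshelve. all: by end_near. Qed.

(** Outside the box f and h differ by at most 2 M, and the probability of leaving it is bounded by a
    union over the coordinates. *)
Lemma expect_trigpoly_dist h (L e : R) : trigpoly h -> (forall x, `|h x| <= M) ->
  (forall x, (forall k, `|x k| <= L) -> `|f (\row_k x k) - h x| <= e) -> 0 <= e ->
  `|\int[P]_w f (\row_k X k w) - \int[P]_w h (X ^~ w)| <=
  e + 2 * M * \sum_k fine (P [set w | L < `|X k w|]).
Proof.
move=> th hM fh e0; have M0 : 0 <= M := le_trans (normr_ge0 _) (fM 0).
pose B k := [set w | L < `|X k w|].
have mB k : measurable (B k).
  rewrite (_ : B k = (fun w => `|X k w|) @^-1` `]L, +oo[%classic).
    rewrite -[X in measurable X]setTI.
    by apply: (measurableT_comp (@normr_measurable R setT) (mX k)).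
  by apply/seteqP; split => w /=; rewrite in_itv/= andbT.
have bB k : @bmeas R d T \1_(B k) by exact: bmeas_indic.
apply: (@le_trans _ _ (\int[P]_w (e + 2 * M * \sum_k \1_(B k) w))).
  apply: expect_dist; [exact: bmeas_continuous|exact: trigpoly_bmeas| |].
    by apply: bmeasD; [exact: bmeas_cst|apply: bmeasZ; exact: bmeas_sum].
  move=> w; have S0 : 0 <= \sum_k \1_(B k) w :> R by apply: sumr_ge0.
  have [near|] := pselect (forall k, `|X k w| <= L).
    by rewrite (le_trans (fh _ near))// lerDl !mulr_ge0.
  move=> /existsNP[k /negP]; rewrite -ltNge => far.
  rewrite (le_trans (ler_normB _ _))//.
  rewrite (@le_trans _ _ (2 * M))//; first by rewrite mulr2n mulrDl !mul1r lerD.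
  rewrite -[leLHS]add0r lerD// -[leLHS]mulr1 ler_wpM2l ?mulr_ge0//.
  rewrite (bigD1 k)//= indicE mem_set// lerDl.
  by apply: sumr_ge0.
rewrite expect_add; [|exact: bmeas_cst|by apply: bmeasZ; exact: bmeas_sum].
rewrite expect_cst expect_scale; last exact: bmeas_sum.
rewrite expect_sum// lerD2l ler_wpM2l ?mulr_ge0//.
by apply: ler_sum => k _; rewrite expect_indic.
Qed.

End trigpoly_expectation.

(** * From characteristic functions to weak convergence *)

Section levy_continuity.
Set Implicit Arguments.
Unset Strict Implicit.
Context {R : realType} {d : measure_display} {T : measurableType d}
  (P : probability T R) {d' : measure_display} {T' : measurableType d'}
  (P' : probability T' R) {n : nat}.
Variables (X : nat -> 'I_n -> T -> R) (Y : 'I_n -> T' -> R).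
Hypothesis mX : forall m k, measurable_fun [set: T] (X m k).
Hypothesis mY : forall k, measurable_fun [set: T'] (Y k).
Hypothesis cvg_cos : forall theta : 'I_n -> R,
  \int[P]_w cos (\sum_k theta k * X m k w) @[m --> \oo] -->
  \int[P']_w cos (\sum_k theta k * Y k w).
Hypothesis cvg_sin : forall theta : 'I_n -> R,
  \int[P]_w sin (\sum_k theta k * X m k w) @[m --> \oo] -->
  \int[P']_w sin (\sum_k theta k * Y k w).

Lemma trigpoly_expect_cvg h : trigpoly h ->
  \int[P]_w h (X m ^~ w) @[m --> \oo] --> \int[P']_w h (Y ^~ w).
Proof.
elim=> {h} [theta|theta|g h tg IHg th IHh|c g tg IH].
- exact: cvg_cos.
- exact: cvg_sin.
- rewrite expect_add; [|exact: trigpoly_bmeas..].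
  under eq_fun do (rewrite expect_add; [|exact: trigpoly_bmeas..]).
  exact: cvgD.
- rewrite expect_scale; last exact: trigpoly_bmeas.
  under eq_fun do (rewrite expect_scale; last exact: trigpoly_bmeas).
  exact: cvgMr.
Qed.

Lemma cvg_cos_coord (k : 'I_n) (t : R) :
  \int[P]_w cos (t * X m k w) @[m --> \oo] --> \int[P']_w cos (t * Y k w).
Proof.
have E (Z : 'I_n -> R) : \sum_i (if i == k then t else 0) * Z i = t * Z k.
  by rewrite (bigD1 k)//= eqxx big1 ?addr0// => i /negbTE ->; rewrite mul0r.
rewrite (_ : (fun m => _) = fun m =>
  \int[P]_w cos (\sum_i (if i == k then t else 0) * X m i w)); last first.
  by apply/funext => m; apply: eq_Rintegral => w _; rewrite E.
rewrite (_ : \int[P']_w _ = \int[P']_w cos (\sum_i (if i == k then t else 0) * Y i w)).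
  exact: cvg_cos.
by apply: eq_Rintegral => w _; rewrite E.
Qed.

(** The estimate on 1 - E cos passes to the limit Y, so one box carries almost all the mass of every
    [X m] and of Y; on it a single trigonometric polynomial replaces f. *)
Lemma levy_continuity (C : R) : 0 <= C ->
  (forall m k (t : R), 0 < t <= 1 -> 1 - \int[P]_w cos (t * X m k w) <= C * t) ->
  forall (f : 'rV[R]_n -> R), continuous f -> (exists M : R, forall v, `|f v| <= M) ->
  \int[P]_w f (\row_k X m k w) @[m --> \oo] --> \int[P']_w f (\row_k Y k w).
Proof.
move=> C0 tightX f cf [M fM].
have tightY k (t : R) : 0 < t <= 1 -> 1 - \int[P']_w cos (t * Y k w) <= C * t.
  move=> t01.
  have c : 1 - \int[P]_w cos (t * X m k w) @[m --> \oo] --> 1 - \int[P']_w cos (t * Y k w).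
    by apply: cvgB; [exact: cvg_cst|exact: cvg_cos_coord].
  rewrite -(cvg_lim _ c)//; apply: limr_le; first by apply/cvg_ex; eexists; exact: c.
  by apply: nearW => m; exact: tightX.
have M0 : 0 <= M := le_trans (normr_ge0 _) (fM 0).
apply/cvgrPdist_le => e e0.
set c := 1 - cos (2^-1 : R); have c0 : 0 < c by exact: one_sub_cos_gt0.
pose K := 2 * M * (n%:R * (C / c)).
have K0 : 0 <= K by rewrite !mulr_ge0// invr_ge0 ltW.
(* Five errors of at most e / 6 are added: approximation and tail for [X m], the same for Y, and the
   distance of the trigonometric expectations. *)
have e6 : 0 < e / 6 by rewrite divr_gt0.
(* The second summand makes K / L <= e / 6; the first gives L >= 1, as the tail bound requires. *)
pose L := 1 + K / (e / 6).
have L1 : 1 <= L by rewrite lerDl divr_ge0// ltW.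
have L0 : 0 < L by exact: lt_le_trans L1.
have tail (S : 'I_n -> R) : (forall k, S k <= C / c / L) ->
    2 * M * \sum_k S k <= e / 6.
  move=> SC; apply: (@le_trans _ _ (K / L)).
    rewrite /K -!mulrA ler_wpM2l// ler_wpM2l//.
    apply: (@le_trans _ _ (\sum_(k < n) C / c / L)); first exact: ler_sum.
    by rewrite sumr_const card_ord mulr_natl -!mulrA.
  by rewrite ler_pdivrMr// mulrDr mulr1 mulrCA divff ?gt_eqF// mulr1 lerDr ltW.
have [h [th hM fh]] := trigpoly_approx cf fM L0 e6.
have dX m := expect_trigpoly_dist P (mX m) cf fM th hM fh (ltW e6).
have dY := expect_trigpoly_dist P' mY cf fM th hM fh (ltW e6).
have tX m := tail _ (fun k => tail_bound (mX m k) C0 L1 (tightX m k)).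
have tY := tail _ (fun k => tail_bound (mY k) C0 L1 (tightY k)).
have /cvgrPdist_le/(_ _ e6) H := trigpoly_expect_cvg th.
near=> m.
have Hm : `|\int[P']_w h (Y ^~ w) - \int[P]_w h (X m ^~ w)| <= e / 6 by near: m.
have := dX m; have := tX m; move: dY tY Hm.
rewrite !ler_norml; lra.
Unshelve. all: by end_near. Qed.

End levy_continuity.

(** * Counting the integer levels below a real number *)

Section layer_cake.
Set Implicit Arguments.
Unset Strict Implicit.
Context {R : realType}.

(** The sum counts the integers from 1 to J not exceeding y; truncating y at J lets the induction on
    J go through. *)
Lemma sum_layers_min (J : nat) (y : R) : 0 <= y ->
  Num.min y J%:R - 1 <= \sum_(j < J) (j.+1%:R <= y)%R%:R <= Num.min y J%:R.
Proof.
move=> y0; elim: J => [|J IH].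
  by rewrite big_ord0 (min_idPr y0) lexx andbT lerBlDr add0r ler01.
rewrite big_ord_recr/=; have [J1y|yJ1] := leP J.+1%:R y.
  have Jy : J%:R <= y by rewrite (le_trans _ J1y)// ler_nat.
  move: IH; rewrite (min_idPr Jy) -natr1 mulr1n.
  by move=> /andP[? ?]; apply/andP; split; lra.
rewrite mulr0n addr0; have [Jy|yJ] := leP J%:R y.
  have -> : \sum_(j < J) (j.+1%:R <= y)%R%:R = J%:R :> R.
    under eq_bigr => j _ do rewrite (le_trans _ Jy) ?ler_nat//.
    by rewrite sumr_const card_ord.
  by move: yJ1; rewrite -natr1 => ?; apply/andP; split; lra.
by move: IH; rewrite (min_idPl (ltW yJ)).
Qed.

Lemma sum_layers (J : nat) (y : R) : 0 <= y <= J%:R ->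
  `|y - \sum_(j < J) (j.+1%:R <= y)%R%:R| <= 1.
Proof.
move=> /andP[y0 yJ]; have := sum_layers_min J y0; rewrite (min_idPl yJ) ler_norml.
by move=> /andP[? ?]; apply/andP; split; lra.
Qed.

End layer_cake.

(** * Product formulas for independent variables *)

Section independence.
Set Implicit Arguments.
Unset Strict Implicit.
Context {R : realType} {d : measure_display} {T : measurableType d}
  (P : probability T R).

Definition bfun (f : R -> R) : Prop :=
  measurable_fun [set: R] f /\ exists M : R, forall x, `|f x| <= M.

Lemma bfun_bmeas f (X : T -> R) : bfun f -> measurable_fun [set: T] X ->
  bmeas (fun w => f (X w)).
Proof. by move=> [mf [M fM]] mX; exact: bmeas_comp mf fM mX. Qed.

Lemma bfun_indic (B : set R) : measurable B -> bfun \1_B.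
Proof.
move=> mB; split; first exact: measurable_indic.
by exists 1 => w; rewrite indicE; case: (_ \in _); rewrite ?normr1 ?normr0.
Qed.

Lemma bfun_cos (c : R) : bfun (fun x => cos (c * x)).
Proof.
split; last by exists 1 => x; exact: cos_max.
apply: (measurableT_comp (f := cos)); last exact: mulrl_measurable.
by apply: continuous_measurable_fun; exact: continuous_cos.
Qed.

Lemma bfun_sin (c : R) : bfun (fun x => sin (c * x)).
Proof.
split; last by exists 1 => x; exact: sin_max.
apply: (measurableT_comp (f := sin)); last exact: mulrl_measurable.
by apply: continuous_measurable_fun; exact: continuous_sin.
Qed.

(* f + M is uniformly within 1 / N of a sum of indicators of superlevel sets. *)
Lemma expect_mul_indep (X W : T -> R) (f : R -> R) :
  measurable_fun [set: T] X -> bmeas W -> bfun f ->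
  (forall B, measurable B -> \int[P]_w (\1_B (X w) * W w) =
     \int[P]_w \1_B (X w) * \int[P]_w W w) ->
  \int[P]_w (f (X w) * W w) = \int[P]_w f (X w) * \int[P]_w W w.
Proof.
move=> mX bW bf H; have [mf [M fM]] := bf.
have M0 : 0 <= M := le_trans (normr_ge0 _) (fM 0).
(* K >= 0 is obtained by integrating, since no point of T is at hand to evaluate W at. *)
have [K WK] := bW.2; have K0 : 0 <= K.
  rewrite -(expect_cst P K) -(expect_cst P 0); apply: expect_le => [||w]; try exact: bmeas_cst.
  exact: le_trans (normr_ge0 _) (WK w).
have bfX := bfun_bmeas bf mX.
apply/eqP; rewrite -subr_eq0 -normr_le0; apply/ler_addgt0Pr => e e0; rewrite add0r.
pose N := (Num.truncn (2 * K / e)).+1.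
have N0 : 0 < N%:R :> R by rewrite ltr0n.
pose J := (Num.truncn (N%:R * (M + M))).+1.
pose B (j : nat) := [set x | j.+1%:R <= N%:R * (f x + M)].
have mB j : measurable (B j).
  have mg : measurable_fun [set: R] (fun x => N%:R * (f x + M)).
    by apply: measurable_funM => //; exact: measurable_funD.
  rewrite (_ : B j = (fun x => N%:R * (f x + M)) @^-1` `[j.+1%:R, +oo[%classic).
    by rewrite -[X in measurable X]setTI; exact: mg.
  by apply/seteqP; split => x /=; rewrite in_itv/= andbT.
pose g x := N%:R^-1 * \sum_(j < J) \1_(B j) x - M : R.
have fg x : `|f x - g x| <= N%:R^-1.
  have /andP[fx0 fx1] : - M <= f x <= M by rewrite -ler_norml.
  have y01 : 0 <= N%:R * (f x + M) <= J%:R.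
    have fM0 : 0 <= f x + M by lra.
    rewrite mulr_ge0 ?ler0n//=.
    rewrite (le_trans _ (ltW (truncnS_gt _)))// ler_wpM2l ?(ltW N0)// lerD2r.
    exact: fx1.
  have := sum_layers y01.
  have -> : f x - g x = N%:R^-1 * (N%:R * (f x + M) - \sum_(j < J) \1_(B j) x).
    by rewrite /g mulrBr mulKf ?gt_eqF//; ring.
  rewrite normrM gtr0_norm ?invr_gt0// => D.
  rewrite -[leRHS]mulr1 ler_wpM2l ?invr_ge0 ?(ltW N0)//.
  rewrite (eq_bigr (fun j : 'I_J => (j.+1%:R <= N%:R * (f x + M))%R%:R))// => j _.
  by rewrite indicE; congr (_%:R); congr nat_of_bool; apply/idP/idP; rewrite inE.
have bBX j : bmeas (fun w => \1_(B j) (X w) : R) := bfun_bmeas (bfun_indic (mB j)) mX.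
have bgX : bmeas (fun w => g (X w)).
  apply: bmeasB; last exact: bmeas_cst.
  by apply: bmeasZ; exact: bmeas_sum.
have EgW : \int[P]_w (g (X w) * W w) = \int[P]_w g (X w) * \int[P]_w W w.
  have -> : \int[P]_w (g (X w) * W w) = \int[P]_w (N%:R^-1 *
      (\sum_(j < J) \1_(B j) (X w) * W w) - M * W w).
    by apply: eq_Rintegral => w _; rewrite /g mulrBl -mulrA mulr_suml.
  have bs : bmeas (fun w => \sum_(j < J) \1_(B j) (X w) * W w).
    by apply: bmeas_sum => j; exact: bmeasM.
  rewrite expect_sub; [|exact: bmeasZ..].
  rewrite !expect_scale// expect_sum; last by move=> j; exact: bmeasM.
  under eq_bigr do rewrite H//.
  rewrite -mulr_suml [in RHS]expect_sub ?expect_cst; [|by apply: bmeasZ; exact: bmeas_sum|exact: bmeas_cst].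
  by rewrite expect_scale ?expect_sum//; [ring|exact: bmeas_sum].
have d1 : `|\int[P]_w (f (X w) * W w) - \int[P]_w (g (X w) * W w)| <= N%:R^-1 * K.
  rewrite -(expect_cst P (N%:R^-1 * K)); apply: expect_dist; try exact: bmeasM.
    exact: bmeas_cst.
  by move=> w; rewrite -mulrBl normrM ler_pM.
have d2 : `|\int[P]_w f (X w) - \int[P]_w g (X w)| <= N%:R^-1.
  by rewrite -(expect_cst P (N%:R^-1)); apply: expect_dist => //; exact: bmeas_cst.
have d3 : `|\int[P]_w W w| <= K.
  rewrite (le_trans (expect_norm P bW))// -(expect_cst P K).
  by apply: expect_le => //; [exact: bmeas_norm|exact: bmeas_cst].
have NK : N%:R^-1 * K + N%:R^-1 * K <= e.
  rewrite -mulrDr ler_pdivrMl// -ler_pdivrMr//.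
  by rewrite (_ : K + K = 2 * K); [exact/ltW/truncnS_gt|ring].
apply: le_trans NK.
(* The formula being exact for g, only two errors of at most K / N remain, and N was chosen for 2 K
   / N <= e. *)
rewrite (_ : _ - _ = (\int[P]_w (f (X w) * W w) - \int[P]_w (g (X w) * W w)) +
  (\int[P]_w g (X w) - \int[P]_w f (X w)) * \int[P]_w W w); last by rewrite EgW; ring.
rewrite (le_trans (ler_normD _ _))// lerD// normrM ler_pM//.
by rewrite distrC.
Qed.

Variables (n : nat) (X : 'I_n -> T -> R).
Hypothesis mX : forall k, measurable_fun [set: T] (X k).
Hypothesis indX : mutually_independent P X.

Lemma indep_prod_indic (B : 'I_n -> set R) : (forall k, measurable (B k)) ->
  \int[P]_w (\prod_k \1_(B k) (X k w)) = \prod_k \int[P]_w \1_(B k) (X k w).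
Proof.
move=> mB.
have mXB k : measurable (X k @^-1` B k) by rewrite -[X in measurable X]setTI; exact: mX.
have -> : \int[P]_w (\prod_k \1_(B k) (X k w)) =
    \int[P]_w \1_(\bigcap_(k in [set: 'I_n]) (X k @^-1` B k)) w.
  apply: eq_Rintegral => w _; rewrite indicE.
  have [/set_mem allB|/negP notB] := boolP (w \in _).
    by rewrite big1// => k _; rewrite indicE mem_set//; exact: allB.
  have [k kB] : exists k, ~ B k (X k w).
    apply/existsNP => allB; apply: notB; rewrite inE => k _; exact: allB.
  by rewrite (bigD1 k)//= indicE memNset// mul0r.
rewrite expect_indic; last first.
  apply: (@fin_bigcap_measurable _ _ _ [set: 'I_n] (fun k => X k @^-1` B k)) => //.
rewrite indX//.
have -> : (\prod_(k < n) P (X k @^-1` B k))%E =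
    (\prod_(k < n) fine (P (X k @^-1` B k)))%:E.
  elim/big_ind2 : _ => //; first by move=> x1 x2 y1 y2 -> ->; rewrite EFinM.
  by move=> k _; rewrite fineK// fin_num_measure.
by apply: eq_bigr => k _; rewrite -expect_indic.
Qed.

Lemma indep_prod (F : 'I_n -> R -> R) : (forall k, bfun (F k)) ->
  \int[P]_w (\prod_k F k (X k w)) = \prod_k \int[P]_w F k (X k w).
Proof.
move=> bF.
(* Here m counts the leading coordinates with arbitrary bounded factors; all later factors are still
   indicators. *)
suff H m : (m <= n)%N -> forall G : 'I_n -> R -> R, (forall k, bfun (G k)) ->
    (forall k : 'I_n, (m <= k)%N -> exists2 B, measurable B & G k = \1_B) ->
    \int[P]_w (\prod_k G k (X k w)) = \prod_k \int[P]_w G k (X k w).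
  by apply: (H n) => // k; rewrite leqNgt ltn_ord.
elim: m => [|m IH] mn G bG indG.
  pose B k := projT1 (cid2 (indG k (leq0n _))).
  have BP k : measurable (B k) /\ G k = \1_(B k).
    by rewrite /B; case: cid2.
  have -> : G = fun k => \1_(B k) by apply/funext => k; exact: (BP k).2.
  by apply: indep_prod_indic => k; exact: (BP k).1.
pose i := Ordinal mn.
pose W w := \prod_(k | k != i) G k (X k w).
have bW : bmeas W.
  rewrite /W; under eq_fun do rewrite big_mkcond; apply: bmeas_prod => k.
  by case: (k != i); [exact: bfun_bmeas|exact: bmeas_cst].
(* An indicator at coordinate i brings the product back within the induction hypothesis; the
   indicator of the whole line will then give the expectation of W itself. *)
have subst (f : R -> R) : bfun f -> (exists2 B, measurable B & f = \1_B) ->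
    \int[P]_w (f (X i w) * W w) =
    \int[P]_w f (X i w) * \prod_(k | k != i) \int[P]_w G k (X k w).
  move=> bf indf; pose G' k := if k == i then f else G k.
  have G'i : G' i = f by rewrite /G' eqxx.
  have G'k k : k != i -> G' k = G k by rewrite /G' => /negbTE ->.
  have IHG' : \int[P]_w (\prod_k G' k (X k w)) = \prod_k \int[P]_w G' k (X k w).
    apply: (IH (ltnW mn)) => k; first by rewrite /G'; case: ifP.
    rewrite leq_eqVlt => /predU1P[mk|mk].
      by have -> : k = i; [exact/val_inj|rewrite G'i].
    rewrite G'k; first exact: indG.
    by apply/negP => /eqP ki; move: mk; rewrite ki ltnn.
  move: IHG'; rewrite [X in _ = X](bigD1 i)//= G'i.
  rewrite [X in _ = _ * X](eq_bigr (fun k => \int[P]_w G k (X k w))); last by move=> k /G'k ->.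
  move=> <-; apply: eq_Rintegral => w _; rewrite (bigD1 i)//= G'i; congr (_ * _).
  by apply: eq_bigr => k /G'k ->.
have EW : \int[P]_w W w = \prod_(k | k != i) \int[P]_w G k (X k w).
  have := subst \1_setT (bfun_indic measurableT) (ex_intro2 _ _ setT measurableT erefl).
  under eq_Rintegral do rewrite indicT mul1r.
  by under [in RHS]eq_Rintegral do rewrite indicT; rewrite expect_cst mul1r.
rewrite (bigD1 i)//= -EW -(@expect_mul_indep (X i) W (G i)) //.
  by apply: eq_Rintegral => w _; rewrite (bigD1 i).
by move=> B mB; rewrite EW subst//; [exact: bfun_indic|exists B].
Qed.

(** The factorisation of the characteristic function of an independent sum, in real form: in the
    addition formulas every term with a sine factor has expectation 0. *)
Lemma indep_cos_sum (c : 'I_n -> R) :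
  (forall k, \int[P]_w sin (c k * X k w) = 0) ->
  \int[P]_w cos (\sum_k c k * X k w) = \prod_k \int[P]_w cos (c k * X k w) /\
  \int[P]_w sin (\sum_k c k * X k w) = 0.
Proof.
move=> sinX.
pose S m w := \sum_(k < n | (k < m)%N) c k * X k w.
(* Arbitrary factors [F k] of the later coordinates are carried along, so that the cosine or sine of
   c_i X_i split off by the addition formula can be absorbed into them. *)
suff H m : (m <= n)%N -> forall F : 'I_n -> R -> R, (forall k, bfun (F k)) ->
    \int[P]_w (cos (S m w) * \prod_(k < n | (m <= k)%N) F k (X k w)) =
      (\prod_(k < n | (k < m)%N) \int[P]_w cos (c k * X k w)) *
      \prod_(k < n | (m <= k)%N) \int[P]_w F k (X k w) /\
    \int[P]_w (sin (S m w) * \prod_(k < n | (m <= k)%N) F k (X k w)) = 0.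
  have [Hc Hs] := H n (leqnn n) (fun=> \1_setT) (fun=> bfun_indic measurableT).
  have E0 (g : 'I_n -> R) : \prod_(k < n | (n <= k)%N) g k = 1.
    by apply: big_pred0 => k; rewrite leqNgt ltn_ord.
  have Sn w : \sum_k c k * X k w = S n w.
    by apply: eq_bigl => k; rewrite ltn_ord.
  split.
    rewrite [in RHS](eq_bigl (fun k : 'I_n => (k < n)%N)); last by move=> k; rewrite ltn_ord.
    rewrite -[RHS]mulr1 -[X in _ = _ * X](E0 (fun k => \int[P]_w \1_setT (X k w))) -Hc.
    by apply: eq_Rintegral => w _; rewrite Sn (E0 (fun k => \1_setT (X k w))) mulr1.
  rewrite -[RHS]Hs.
  by apply: eq_Rintegral => w _; rewrite Sn (E0 (fun k => \1_setT (X k w))) mulr1.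
elim: m => [|m IH] mn F bF.
  rewrite [X in X * _]big_pred0// mul1r.
  have S0 w : S 0%N w = 0 by rewrite /S big_pred0.
  split.
    rewrite -indep_prod//; apply: eq_Rintegral => w _.
    by rewrite S0 cos0 mul1r.
  rewrite -[RHS](expect_cst P 0); apply: eq_Rintegral => w _.
  by rewrite S0 sin0 mul0r.
pose i := Ordinal mn.
have Sm w : S m.+1 w = c i * X i w + S m w.
  rewrite /S (bigD1 i)/= ?ltnSn//; congr (_ + _); apply: eq_bigl => k.
  by rewrite ltnS -(inj_eq val_inj) andbC -ltn_neqAle.
have splitI (g : 'I_n -> R) :
    \prod_(k < n | (m <= k)%N) g k = g i * \prod_(k < n | (m.+1 <= k)%N) g k.
  rewrite (bigD1 i)//=; congr (_ * _); apply: eq_bigl => k.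
  by rewrite ltn_neqAle andbC eq_sym.
pose Fi f k := if k == i then f else F k.
have bFi f : bfun f -> forall k, bfun (Fi f k) by move=> bf k; rewrite /Fi; case: ifP.
have Fii f (g : (R -> R) -> 'I_n -> R) :
    \prod_(k < n | (m <= k)%N) g (Fi f k) k =
    g f i * \prod_(k < n | (m.+1 <= k)%N) g (F k) k.
  rewrite splitI {1}/Fi eqxx; congr (_ * _); apply: eq_bigr => k mk.
  rewrite /Fi; case: eqP => // ki; by move: mk; rewrite ki ltnn.
have [c1 s1] := IH (ltnW mn) _ (bFi _ (bfun_cos (c i))).
have [c2 s2] := IH (ltnW mn) _ (bFi _ (bfun_sin (c i))).
have mS k : measurable_fun [set: T] (S k).
  rewrite /S; under eq_fun do rewrite big_mkcond; apply: measurable_sum => j.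
  by case: (j < k)%N => //; exact: measurable_funM.
have bPr f : bfun f -> bmeas (fun w => \prod_(k < n | (m <= k)%N) Fi f k (X k w)).
  move=> bf; under eq_fun do rewrite big_mkcond; apply: bmeas_prod => k.
  by case: (m <= k)%N; [exact/bfun_bmeas/mX/bFi|exact: bmeas_cst].
have bcP f : bfun f ->
    bmeas (fun w => cos (S m w) * \prod_(k < n | (m <= k)%N) Fi f k (X k w)).
  by move=> bf; apply: bmeasM; [exact: bmeas_cos|exact: bPr].
have bsP f : bfun f ->
    bmeas (fun w => sin (S m w) * \prod_(k < n | (m <= k)%N) Fi f k (X k w)).
  by move=> bf; apply: bmeasM; [exact: bmeas_sin|exact: bPr].
split.
  transitivity (\int[P]_w (cos (S m w) *
        \prod_(k < n | (m <= k)%N) Fi (fun x => cos (c i * x)) k (X k w)) -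
      \int[P]_w (sin (S m w) *
        \prod_(k < n | (m <= k)%N) Fi (fun x => sin (c i * x)) k (X k w))).
    rewrite -expect_sub; [|exact/bcP/bfun_cos|exact/bsP/bfun_sin].
    apply: eq_Rintegral => w _; rewrite !(Fii _ (fun f k => f (X k w))) Sm cosD.
    by ring.
  rewrite c1 s2 subr0 (Fii _ (fun f k => \int[P]_w f (X k w))) mulrA; congr (_ * _).
  rewrite [RHS](bigD1 i)/= ?ltnSn// mulrC; congr (_ * _); apply: eq_bigl => k.
  by rewrite ltnS -(inj_eq val_inj) andbC -ltn_neqAle.
transitivity (\int[P]_w (cos (S m w) *
      \prod_(k < n | (m <= k)%N) Fi (fun x => sin (c i * x)) k (X k w)) +
    \int[P]_w (sin (S m w) *
      \prod_(k < n | (m <= k)%N) Fi (fun x => cos (c i * x)) k (X k w))).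
  rewrite -expect_add; [|exact/bcP/bfun_sin|exact/bsP/bfun_cos].
  apply: eq_Rintegral => w _; rewrite !(Fii _ (fun f k => f (X k w))) Sm sinD.
  by ring.
by rewrite c2 s1 addr0 (Fii _ (fun f k => \int[P]_w f (X k w))) sinX mul0r mulr0.
Qed.

End independence.

(** * Real and imaginary parts of the characteristic function *)

Section expect_cis_parts.
Set Implicit Arguments.
Unset Strict Implicit.
Context {R : realType} {d : measure_display} {T : measurableType d}
  (P : probability T R).

Lemma expect_cisP (Y : T -> R) (x : R) :
  expect_cis P Y = (x%:C)%C <->
  \int[P]_w cos (Y w) = x /\ \int[P]_w sin (Y w) = 0.
Proof. by split=> [[-> ->]|[c s]]//; rewrite /expect_cis c s. Qed.

Lemma expect_ae_eq (f g : T -> R) : bmeas f -> bmeas g ->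
  {ae P, forall w, f w = g w} -> \int[P]_w f w = \int[P]_w g w.
Proof.
move=> bf bg fg; rewrite /Rintegral; congr fine; apply: ae_eq_integral => //.
- exact/measurable_EFinP/bf.1.
- exact/measurable_EFinP/bg.1.
- by apply: filterS fg => w fgw _; rewrite /= fgw.
Qed.

End expect_cis_parts.

(** * Additivity of a stable random measure and its simple integrals *)

Section stable_random_measure.
Set Implicit Arguments.
Unset Strict Implicit.
Context {R : realType} {d : measure_display} {T : measurableType d}
  (P : probability T R) (p : R) (Z : set R -> {RV P >-> R}).
Hypothesis p0 : 0 < p.
Hypothesis hZ : stable_random_measure p Z.
Local Notation mu := (@lebesgue_measure R).

Lemma finite_borel0 : finite_borel (@set0 R).
Proof. by split; [exact: measurable0|rewrite measure0]. Qed.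

(** Countable additivity for a sequence of empty sets makes n z converge, where z = Z(empty set);
    the differences of consecutive terms equal z and tend to 0. *)
Lemma stable_measure0 : {ae P, forall w, Z set0 w = 0}.
Proof.
have [_ _ /(_ (fun=> set0))] := hZ.
rewrite bigcup0// => add0.
have {}add0 := add0 (fun=> finite_borel0) _ finite_borel0.
apply: filterS (add0 _); last by apply/trivIsetP => i j _ _ _; rewrite setI0.
move=> w; set z := Z set0 w => cz.
have cz1 : \sum_(k < n.+1) z @[n --> \oo] --> z.
  by rewrite (cvg_shiftS (fun n => \sum_(k < n) z)).
have c0 : \sum_(k < n.+1) z - \sum_(k < n) z @[n --> \oo] --> z - z.
  exact: cvgB cz1 cz.
rewrite -(subrr z) -(cvg_lim _ c0)//.
under eq_fun do rewrite big_ord_recr/= addrAC subrr add0r.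
by rewrite norm_lim_cst.
Qed.

Lemma stable_measure_add (n : nat) (B : 'I_n -> set R) :
  (forall k, finite_borel (B k)) -> trivIset [set: 'I_n] B ->
  finite_borel (\bigcup_(k in [set: 'I_n]) B k) ->
  {ae P, forall w, Z (\bigcup_(k in [set: 'I_n]) B k) w = \sum_k Z (B k) w}.
Proof.
(* Padding with empty sets reduces finite additivity to countable additivity: the extra terms vanish
   almost surely. *)
move=> fB tB fUB; pose A (j : nat) := if insub j is Some k then B k else set0.
have AB (k : 'I_n) : A k = B k by rewrite /A valK.
have A0 j : (n <= j)%N -> A j = set0.
  by move=> nj; rewrite /A insubF// ltnNge nj.
have UA : \bigcup_j A j = \bigcup_(k in [set: 'I_n]) B k.
  apply/seteqP; split => x.
    move=> [j _]; rewrite /A; case: insubP => // k _ _ Bx; by exists k.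
  by move=> [k _ Bx]; exists k => //; rewrite AB.
have [_ _ addZ] := hZ.
have fA j : finite_borel (A j).
  by rewrite /A; case: insubP => // _; exact: finite_borel0.
have tA : trivIset [set: nat] A.
  move=> i j _ _ [x]; rewrite /A.
  case: insubP => [ki _ <-|_ []//]; case: insubP => [kj _ <-|_ []//] Bx.
  by congr nat_of_ord; apply: tB => //; exists x.
have {}addZ : {ae P, forall w, \sum_(k < m) Z (A k) w @[m --> \oo] --> Z (\bigcup_j A j) w}.
  by apply: addZ => //; rewrite UA.
apply: filterS2 stable_measure0 addZ => w Z0; rewrite UA => cA.
have sumA N : \sum_(k < N + n) Z (A k) w = \sum_k Z (B k) w.
  elim: N => [|N IH]; first by apply: eq_bigr => k _; rewrite AB.
  by rewrite addSn big_ord_recr/= IH A0 ?leq_addl// Z0 addr0.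
move: cA; rewrite -(cvg_shiftn n) /= => cA.
rewrite -(cvg_lim _ cA)//.
under eq_fun do rewrite sumA.
by rewrite norm_lim_cst.
Qed.

Lemma Rintegral_sum_indic (n : nat) (b : 'I_n -> R) (B : 'I_n -> set R) :
  (forall j, finite_borel (B j)) ->
  \int[mu]_x (\sum_j b j * \1_(B j) x) = \sum_j b j * fine (mu (B j)).
Proof.
move=> fB.
have iB j : mu.-integrable [set: R] (EFin \o (fun x => b j * \1_(B j) x)).
  have [mB Bfin] := fB j.
  rewrite (_ : EFin \o _ = fun x => ((b j)%:E * (\1_(B j) x)%:E)%E)//.
  apply: integrableZl => //; apply/integrableP; split.
    exact/measurable_EFinP/measurable_indic.
  under eq_integral do rewrite gee0_abs ?lee_fin//.
  by rewrite integral_indic// setIT.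
have [_ ->] : mu.-integrable [set: R] (EFin \o (fun x => \sum_j b j * \1_(B j) x)) /\
    \int[mu]_x (\sum_j b j * \1_(B j) x) =
    \sum_j \int[mu]_x (b j * \1_(B j) x).
  elim: (index_enum _) => [|j s [intS IH]].
    split; last first.
      by rewrite big_nil; under eq_Rintegral do rewrite big_nil; rewrite Rintegral_cst// mul0r.
    rewrite (_ : EFin \o _ = cst 0%E); first exact: integrable0.
    by apply/funext => x /=; rewrite big_nil.
  split.
    rewrite (_ : EFin \o _ = fun x => (b j * \1_(B j) x)%:E + (\sum_(j <- s) b j * \1_(B j) x)%:E)%E.
      exact: integrableD (iB j) intS.
    by apply/funext => x /=; rewrite big_cons EFinD.
  rewrite big_cons -IH; under eq_Rintegral do rewrite big_cons.
  exact: RintegralD.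
apply: eq_bigr => j _; have [mB Bfin] := fB j.
rewrite RintegralZl//; first by rewrite /Rintegral integral_indic// setIT.
apply/integrableP; split.
  exact/measurable_EFinP/measurable_indic.
under eq_integral do rewrite gee0_abs ?lee_fin//.
by rewrite integral_indic// setIT.
Qed.

Lemma stable_simple (I : finType) (c : I -> R) (A : I -> set R) :
  (forall k, finite_borel (A k)) ->
  \int[P]_w cos (\sum_k c k * Z (A k) w) =
    expR (- \int[mu]_x (`|\sum_k c k * \1_(A k) x| `^ p)) /\
  \int[P]_w sin (\sum_k c k * Z (A k) w) = 0.
Proof.
(* The atoms B j are indexed by the subsets sg j of I; the atom of the empty
   subset, the complement of all A i, is replaced by the empty set as it has
   infinite measure. *)
move=> fA; pose n := #|{set I}|; pose sg (j : 'I_n) : {set I} := enum_val j.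
pose B (j : 'I_n) := [set x | (exists i : I, A i x) /\
                         forall i : I, A i x <-> i \in sg j].
(* The constant value of the simple function on the atom [B j]. *)
pose b j := \sum_i c i * (i \in sg j)%:R.
have B1A j x (i : I) : B j x -> \1_(A i) x = (i \in sg j)%:R :> R.
  move=> [_ Bx]; rewrite indicE; congr (_%:R); congr nat_of_bool; apply/idP/idP.
    by rewrite inE => /Bx.
  by move=> /Bx; rewrite inE.
have BA x (i : I) : A i x -> exists2 j, B j x & i \in sg j.
  move=> Ax; exists (enum_rank [set k : I | `[< A k x >]]%SET); last first.
    by rewrite /sg enum_rankK inE; apply/asboolP.
  split; first by exists i.
  by move=> k; rewrite /sg enum_rankK inE; split => /asboolP.
have mB j : measurable (B j).
  rewrite (_ : B j = (\bigcup_(i in [set: I]) A i) `&`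
      \bigcap_(i in [set: I]) (if i \in sg j then A i else ~` A i)).
    apply: measurableI.
      by apply: fin_bigcup_measurable => // i _; exact: (fA i).1.
    apply: fin_bigcap_measurable => // i _; case: ifP => _; first exact: (fA i).1.
    by apply: measurableC; exact: (fA i).1.
  apply/seteqP; split => x.
    move=> [[i Ax] Bx]; split; first by exists i.
    by move=> k _; case: ifPn => [/Bx//|ksg /Bx]; exact/negP.
  move=> [[i _ Ax] Bx]; split; first by exists i.
  move=> k; have := Bx k Logic.I; case: ifPn => //= ksg kx; split => //.
have subB j x : B j x -> exists i : I, i \in sg j.
  by move=> [[i Ax] Bx]; exists i; exact/Bx.
have fB j : finite_borel (B j).
  split; first exact: mB.
  have [i isg|none] := pickP [pred i | i \in sg j].
    apply: le_lt_trans (fA i).2; apply: le_measure; rewrite ?inE.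
    - exact: mB.
    - exact: (fA i).1.
    - by move=> x [_ Bx]; exact/Bx.
  rewrite (_ : B j = set0) ?measure0//; apply/seteqP; split => // x /subB[i isg].
  by have := none i; rewrite /= isg.
have tB : trivIset [set: 'I_n] B.
  move=> j k _ _ [x [[_ Bj] [_ Bk]]]; apply: enum_val_inj; apply/setP => i.
  by apply/idP/idP => [/Bj/Bk|/Bk/Bj].
have ZA (i : I) : {ae P, forall w, Z (A i) w = \sum_j (i \in sg j)%:R * Z (B j) w}.
  pose C j := if i \in sg j then B j else set0.
  have fC j : finite_borel (C j) by rewrite /C; case: ifP => // _; exact: finite_borel0.
  have tC : trivIset [set: 'I_n] C.
    move=> j k _ _ [x]; rewrite /C; case: ifP => _ []// Bj; case: ifP => _// Bk.
    by apply: tB => //; exists x.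
  have UC : \bigcup_(j in [set: 'I_n]) C j = A i.
    apply/seteqP; split => x.
      by move=> [j _]; rewrite /C; case: ifPn => // isg [_ Bx]; exact/Bx.
    by move=> /BA[j Bx isg]; exists j => //; rewrite /C isg.
  have := stable_measure_add fC tC; rewrite UC => /(_ (fA i)).
  apply: filterS2 stable_measure0 => w Z0 ->; apply: eq_bigr => j _.
  by rewrite /C; case: ifP => _; rewrite ?mul1r// Z0 mul0r.
have ZAs : {ae P, forall w, \sum_k c k * Z (A k) w = \sum_j b j * Z (B j) w}.
  have : {ae P, forall w, forall i : I, Z (A i) w = \sum_j (i \in sg j)%:R * Z (B j) w}.
    exact: filter_forall.
  apply: filterS => w ZAw; under eq_bigr do rewrite ZAw mulr_sumr.
  rewrite exchange_big/=; apply: eq_bigr => j _; rewrite mulr_suml.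
  by apply: eq_bigr => i _; rewrite mulrA.
(* A point lies in at most one atom, so the power commutes with the sum; outside all atoms both
   sides are 0 because p > 0. *)
have fE x : `|\sum_k c k * \1_(A k) x| `^ p = \sum_j `|b j| `^ p * \1_(B j) x.
  have [[j Bx]|noB] := pselect (exists j, B j x).
    rewrite (bigD1 j)//= [in RHS]indicE mem_set// mulr1 [X in _ = _ + X]big1 ?addr0; last first.
      move=> k kj; rewrite indicE memNset ?mulr0// => Bk.
      by move: kj; rewrite (tB k j Logic.I Logic.I) ?eqxx//; exists x.
    by congr (`|_| `^ _); apply: eq_bigr => i _; rewrite (B1A _ _ _ Bx).
  rewrite !big1 ?normr0 ?powR0 ?gt_eqF//.
    by move=> j _; rewrite indicE memNset ?mulr0// => Bx; apply: noB; exists j.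
  by move=> i _; rewrite indicE memNset ?mulr0// => /BA[j Bx _]; apply: noB; exists j.
have IE : \int[mu]_x (`|\sum_k c k * \1_(A k) x| `^ p) =
    \sum_j `|b j| `^ p * fine (mu (B j)).
  by under eq_Rintegral do rewrite fE; exact: Rintegral_sum_indic.
have [chZ indZ _] := hZ.
have chB j : \int[P]_w cos (b j * Z (B j) w) = expR (- (`|b j| `^ p * fine (mu (B j)))) /\
    \int[P]_w sin (b j * Z (B j) w) = 0.
  by apply/expect_cisP/chZ.
have mZ (D : set R) : measurable_fun [set: T] (Z D : T -> R) by [].
have [ccos csin] := indep_cos_sum (fun j => mZ (B j)) (indZ _ _ fB tB)
  (fun j => (chB j).2).
have mA : measurable_fun [set: T] (fun w => \sum_k c k * Z (A k) w).
  by apply: measurable_sum => k; exact: measurable_funM.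
have mBs : measurable_fun [set: T] (fun w => \sum_j b j * Z (B j) w).
  by apply: measurable_sum => k; exact: measurable_funM.
split.
  rewrite (expect_ae_eq (bmeas_cos mA) (bmeas_cos mBs)); last first.
    by apply: filterS ZAs => w ->.
  by rewrite ccos IE -sumrN expR_sum; apply: eq_bigr => j _; exact: (chB j).1.
rewrite (expect_ae_eq (bmeas_sin mA) (bmeas_sin mBs)) ?csin//.
by apply: filterS ZAs => w ->.
Qed.

End stable_random_measure.

(** * Joint continuity of powers and Lipschitz bounds *)

Section powR_limits.
Set Implicit Arguments.
Unset Strict Implicit.
Context {R : realType}.

(** Base and exponent move together, and the base may tend to 0, as happens where a kernel
    vanishes. *)
Lemma powR_cvg (I : Type) (F : set_system I) (FF : ProperFilter F)
    (x q : I -> R) (x0 q0 : R) : (forall i, 0 <= x i) ->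
  x i @[i --> F] --> x0 -> q i @[i --> F] --> q0 -> 0 < q0 ->
  x i `^ q i @[i --> F] --> x0 `^ q0.
Proof.
move=> xge0 cx cq q00.
have x00 : 0 <= x0.
  rewrite -(cvg_lim _ cx)//; apply: limr_ge; first by apply/cvg_ex; eexists; exact: cx.
  exact: nearW.
move: x00; rewrite le_eqVlt => /predU1P[x0E|x00].
  (* At base 0, eventually q >= q0 / 2 and x <= 1, whence x^q <= x^(q0 / 2) <= e once x <= e^(2 /
     q0). *)
  rewrite -x0E powR0 ?gt_eqF//; rewrite -x0E in cx.
  apply/cvgrPdist_le => e e0; near=> n.
  rewrite sub0r normrN ger0_norm ?powR_ge0//.
  have q2 : q0 / 2 <= q n.
    near: n; apply: (cvgr_ge _ cq); rewrite ltr_pdivrMr// mulr2n mulrDr mulr1; lra.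
  have q20 : 0 < q0 / 2 by rewrite divr_gt0.
  have x1 : x n <= 1 by near: n; exact: (cvgr_le _ cx).
  have xe : x n <= e `^ (q0 / 2)^-1.
    by near: n; apply: (cvgr_le _ cx); exact: powR_gt0.
  have [xn0|xn0] := eqVneq (x n) 0.
    by rewrite xn0 powR0 ?ltW// gt_eqF// (lt_le_trans q20).
  apply: (@le_trans _ _ (x n `^ (q0 / 2))).
    by apply: ger_powR; rewrite ?x1 ?lt_neqAle 1?eq_sym ?xn0 ?xge0.
  apply: (@le_trans _ _ ((e `^ (q0 / 2)^-1) `^ (q0 / 2))).
    by apply: ge0_ler_powR => //; rewrite ?nnegrE ?powR_ge0// ltW.
  by rewrite -powRrM mulVf ?powRr1 ?gt_eqF// ltW.
have c : expR (q i * ln (x i)) @[i --> F] --> x0 `^ q0.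
  rewrite /powR gt_eqF//.
  apply: (@cvg_comp _ _ _ (fun n => q n * ln (x n)) expR); last exact: continuous_expR.
  by apply: cvgM => //; exact: (continuous_cvg _ (continuous_ln x00)).
apply: cvg_trans c; apply: near_eq_cvg; near=> n.
rewrite /powR gt_eqF//; near: n; exact: (cvgr_gt _ cx).
Unshelve. all: by end_near. Qed.

Lemma derive_bound_dist (f df : R -> R) (K x y : R) : x <= y ->
  (forall z : R, x <= z <= y -> is_derive z 1 f (df z)) ->
  (forall z : R, x <= z <= y -> `|df z| <= K) -> `|f y - f x| <= K * (y - x).
Proof.
move=> xy fdf dfK.
have [||c cxy ->] := @MVT_segment R f df x y xy.
- by move=> z; rewrite in_itv/= => /andP[/ltW xz /ltW zy]; apply: fdf; rewrite xz.
- apply: continuous_in_subspaceT => z; rewrite inE/= in_itv/= => zxy.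
  by apply: differentiable_continuous; apply/derivable1_diffP; have [] := fdf z zxy.
- rewrite normrM [`|y - x|]ger0_norm ?subr_ge0// ler_wpM2r ?subr_ge0//.
  by apply: dfK; move: cxy; rewrite in_itv.
Qed.

Lemma derive_lipschitz (f df : R -> R) (K : R) :
  (forall x : R, is_derive x 1 f (df x)) -> (forall x, `|df x| <= K) ->
  forall x y, `|f x - f y| <= K * `|x - y|.
Proof.
move=> fdf dfK x y.
have D := fun x y xy => derive_bound_dist xy (fun z _ => fdf z) (fun z _ => dfK z).
have [xy|/ltW yx] := leP x y.
  by rewrite distrC [`|x - y|]distrC [`|y - x|]ger0_norm ?subr_ge0//; exact: D.
by rewrite [`|x - y|]ger0_norm ?subr_ge0//; exact: D.
Qed.

Lemma cos_dist (x y : R) : `|cos x - cos y| <= `|x - y|.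
Proof.
rewrite -[leRHS]mul1r; apply: (@derive_lipschitz cos (fun z => - sin z)) => z.
by rewrite normrN sin_max.
Qed.

Lemma sin_dist (x y : R) : `|sin x - sin y| <= `|x - y|.
Proof.
by rewrite -[leRHS]mul1r; apply: (@derive_lipschitz sin cos) => z; exact: cos_max.
Qed.

End powR_limits.

(** * The L^p seminorm as a real number *)

Section Lp.
Set Implicit Arguments.
Unset Strict Implicit.
Context {R : realType} {d : measure_display} {T : measurableType d}
  (mu : {measure set T -> \bar R}) (p : R).
Hypothesis p1 : 1 <= p.
Implicit Types f g : T -> R.

Let p0 : 0 < p. Proof. exact: lt_le_trans p1. Qed.

Lemma measurable_norm_powR f : measurable_fun [set: T] f ->
  measurable_fun [set: T] (fun x => `|f x| `^ p).
Proof.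
move=> mf; apply: (measurableT_comp (f := fun y => y `^ p)).
  exact: measurable_powR.
exact: measurableT_comp.
Qed.

Definition in_Lp f : Prop :=
  measurable_fun [set: T] f /\ (\int[mu]_x (`|f x| `^ p)%:E < +oo)%E.

(** Meaningful on [in_Lp] only: an infinite integral is read as 0. *)
Definition Lp_norm f : R := (\int[mu]_x (`|f x| `^ p)) `^ p^-1.

Lemma Lp_norm_ge0 f : 0 <= Lp_norm f. Proof. exact: powR_ge0. Qed.

Lemma Lp_normX f : Lp_norm f `^ p = \int[mu]_x (`|f x| `^ p).
Proof.
rewrite /Lp_norm -powRrM mulVf ?gt_eqF// powRr1//.
by apply: Rintegral_ge0 => x _; exact: powR_ge0.
Qed.

Lemma Lnorm_EFin f : Lnorm mu p%:E (EFin \o f) =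
  ((\int[mu]_x (`|f x| `^ p)%:E) `^ p^-1)%E.
Proof.
by rewrite unlock.
Qed.

Lemma Lp_norm_fine f : in_Lp f -> Lnorm mu p%:E (EFin \o f) = (Lp_norm f)%:E.
Proof.
move=> [mf ifoo]; rewrite Lnorm_EFin -[X in (X `^ _)%E]fineK; last first.
  by rewrite ge0_fin_numE// integral_ge0// => x _; rewrite lee_fin powR_ge0.
by rewrite poweR_EFin.
Qed.

Lemma in_LpD f g : in_Lp f -> in_Lp g -> in_Lp (fun x => f x + g x).
Proof.
move=> Lf Lg; split; first by apply: measurable_funD; [exact: Lf.1|exact: Lg.1].
have := minkowski_EFin mu Lf.1 Lg.1 p1; rewrite (Lp_norm_fine Lf) (Lp_norm_fine Lg) Lnorm_EFin => H.
have : ((\int[mu]_x (`|f x + g x| `^ p)%:E) `^ p^-1 < +oo)%E.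
  by apply: le_lt_trans H _; rewrite ltry.
by apply: lty_poweRy; rewrite invr_neq0// gt_eqF.
Qed.

Lemma Lp_normD f g : in_Lp f -> in_Lp g ->
  Lp_norm (fun x => f x + g x) <= Lp_norm f + Lp_norm g.
Proof.
move=> Lf Lg; have := minkowski_EFin mu Lf.1 Lg.1 p1.
by rewrite !Lp_norm_fine//; exact: in_LpD.
Qed.

Lemma in_LpZ c f : in_Lp f -> in_Lp (fun x => c * f x).
Proof.
move=> [mf ifoo]; split; first exact: measurable_funM.
under eq_integral do rewrite normrM powRM// EFinM.
rewrite ge0_integralZl ?lee_fin ?powR_ge0//.
- by rewrite lte_mul_pinfty// lee_fin powR_ge0.
- exact/measurable_EFinP/measurable_norm_powR.
Qed.

Lemma Lp_normZ c f : in_Lp f -> Lp_norm (fun x => c * f x) = `|c| * Lp_norm f.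
Proof.
move=> [mf ifoo]; rewrite /Lp_norm.
under eq_Rintegral do rewrite normrM powRM//.
rewrite RintegralZl//; last first.
  apply/integrableP; split.
    exact/measurable_EFinP/measurable_norm_powR.
  by under eq_integral do rewrite gee0_abs ?lee_fin ?powR_ge0//.
rewrite powRM ?powR_ge0//; last by apply: Rintegral_ge0 => x _; exact: powR_ge0.
by rewrite -powRrM mulfV ?gt_eqF// powRr1.
Qed.

Lemma in_Lp0 : in_Lp (fun=> 0).
Proof.
split; first exact: measurable_cst.
by under eq_integral do rewrite normr0 powR0 ?gt_eqF//; rewrite integral0 ltry.
Qed.

Lemma Lp_norm0 : Lp_norm (fun=> 0) = 0.
Proof.
rewrite /Lp_norm; under eq_Rintegral do rewrite normr0 powR0 ?gt_eqF//.
by rewrite /Rintegral integral0 powR0// invr_neq0// gt_eqF.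
Qed.

Lemma in_Lp_sum (I : Type) (s : seq I) (F : I -> T -> R) :
  (forall i, in_Lp (F i)) -> in_Lp (fun x => \sum_(i <- s) F i x).
Proof.
move=> LF; elim: s => [|i s IH].
  by under eq_fun do rewrite big_nil; exact: in_Lp0.
by under eq_fun do rewrite big_cons; exact: in_LpD.
Qed.

Lemma Lp_norm_sum (I : Type) (s : seq I) (F : I -> T -> R) :
  (forall i, in_Lp (F i)) ->
  Lp_norm (fun x => \sum_(i <- s) F i x) <= \sum_(i <- s) Lp_norm (F i).
Proof.
move=> LF; elim: s => [|i s IH].
  by under eq_fun do rewrite big_nil; rewrite big_nil Lp_norm0.
under eq_fun do rewrite big_cons; rewrite big_cons.
by rewrite (le_trans (Lp_normD (LF i) (in_Lp_sum _ LF)))// lerD2l.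
Qed.

End Lp.

(** * Expectations under convergence in probability *)

Section convergence_in_probability.
Set Implicit Arguments.
Unset Strict Implicit.
Context {R : realType} {d : measure_display} {T : measurableType d}
  (P : probability T R) (n : nat) (theta : 'I_n -> R).
Variables (S : nat -> 'I_n -> T -> R) (Y : 'I_n -> T -> R).
Hypothesis mS : forall N k, measurable_fun [set: T] (S N k).
Hypothesis mY : forall k, measurable_fun [set: T] (Y k).
Hypothesis SY : forall k e, 0 < e ->
  P [set w | e <= `|S N k w - Y k w|] @[N --> \oo] --> 0%E.

Lemma expect_cvg_in_prob (h : R -> R) : measurable_fun [set: R] h ->
  (forall x, `|h x| <= 1) -> (forall x y, `|h x - h y| <= `|x - y|) ->
  \int[P]_w h (\sum_k theta k * S N k w) @[N --> \oo] -->
  \int[P]_w h (\sum_k theta k * Y k w).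
Proof.
move=> mh h1 hlip; apply/cvgrPdist_le => e e0.
(* If every coordinate moves by less than r = e / (2 W), the linear form moves by at most e / 2; the
   summand 1 keeps W positive when theta is 0. *)
pose W := 1 + \sum_k `|theta k|.
have W0 : 0 < W by rewrite ltr_pwDl// sumr_ge0.
pose r := e / 2 / W; have r0 : 0 < r by rewrite !divr_gt0.
pose B N k := [set w | r <= `|S N k w - Y k w|].
have mB N k : measurable (B N k).
  rewrite (_ : B N k = (fun w => `|S N k w - Y k w|) @^-1` `[r, +oo[%classic).
    rewrite -[X in measurable X]setTI; apply: measurableT_comp => //.
    exact: measurable_funB.
  by apply/seteqP; split => w /=; rewrite in_itv/= andbT.
have Bcvg : \sum_k 2 * fine (P (B N k)) @[N --> \oo] --> 0.
  rewrite [X in _ --> X](_ : 0 = \sum_(k < n) 2 * 0 :> R); last first.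
    by rewrite big1// => k _; rewrite mulr0.
  apply: cvg_big => [|k _]; [exact: add_continuous|apply: cvgMr].
  by apply: fine_cvg; exact: SY.
have bh (Z : 'I_n -> T -> R) : (forall k, measurable_fun [set: T] (Z k)) ->
    bmeas (fun w => h (\sum_k theta k * Z k w)).
  move=> mZ; apply: (bmeas_comp mh h1).
  by apply: measurable_sum => k; exact: measurable_funM.
have bB N k : @bmeas R d T \1_(B N k) by exact: bmeas_indic.
have e2 : 0 < e / 2 by rewrite divr_gt0.
near=> N.
apply: (@le_trans _ _ (\int[P]_w (e / 2 + \sum_k 2 * \1_(B N k) w))).
  apply: expect_dist; [exact: bh|exact: bh| |].
    by apply: bmeasD; [exact: bmeas_cst|apply: bmeas_sum => k; exact: bmeasZ].
  move=> w.
  have S0 : 0 <= \sum_k 2 * \1_(B N k) w :> R by apply: sumr_ge0 => k _; rewrite mulr_ge0.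
  have [near|] := pselect (forall k, `|S N k w - Y k w| < r).
    rewrite (le_trans (hlip _ _))// -sumrB (le_trans (ler_norm_sum _ _ _))//.
    rewrite -[leLHS]addr0 lerD//.
    apply: (@le_trans _ _ (\sum_k `|theta k| * r)).
      apply: ler_sum => k _; rewrite -mulrBr normrM ler_wpM2l// distrC.
      exact/ltW/near.
    rewrite -mulr_suml /r mulrA ler_pdivrMr// mulrC ler_wpM2l ?(ltW e2)//.
    by rewrite lerDr.
  move=> /existsNP[k /negP]; rewrite -leNgt => far.
  rewrite (le_trans (ler_normB _ _))// -[leLHS]add0r lerD ?(ltW e2)//.
  rewrite [leRHS](bigD1 k)//= indicE mem_set// mulr1 (@le_trans _ _ 2)//.
    by rewrite (_ : 2 = 1 + 1)// lerD.
  by rewrite lerDl sumr_ge0// => j _; rewrite mulr_ge0.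
rewrite expect_add; [|exact: bmeas_cst|by apply: bmeas_sum => k; exact: bmeasZ].
rewrite expect_cst expect_sum; last by move=> k; exact: bmeasZ.
rewrite [leRHS]splitr lerD2l.
under eq_bigr do rewrite expect_scale// expect_indic//.
near: N; exact: (cvgr_le _ Bcvg).
Unshelve. all: by end_near. Qed.

End convergence_in_probability.

(** * Characteristic functions of stable integrals *)

Section stable_integral.
Set Implicit Arguments.
Unset Strict Implicit.
Context {R : realType} {d : measure_display} {T : measurableType d}
  (P : probability T R) (p : R) (Z : set R -> {RV P >-> R}).
Hypothesis p1 : 1 <= p.
Hypothesis hZ : stable_random_measure p Z.
Local Notation mu := (@lebesgue_measure R).

Let p0 : 0 < p. Proof. exact: lt_le_trans p1. Qed.

Lemma in_Lp_indic (A : set R) : finite_borel A -> in_Lp mu p (\1_A : R -> R).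
Proof.
move=> [mA Afin]; split; first exact: measurable_indic.
under eq_integral => x _.
  rewrite (_ : (`|\1_A x| `^ p)%:E = (\1_A x)%:E); first over.
  rewrite indicE; case: (_ \in _); rewrite ?normr1 ?powR1// normr0 powR0// gt_eqF//.
by rewrite integral_indic// setIT.
Qed.

(** The simple approximants of all the [f k] are combined at each level N; their exponents converge
    by continuity of the L^p norm, their cosines and sines by convergence in probability. *)
Lemma stable_integral_cis (n : nat) (theta : 'I_n -> R) (f : 'I_n -> R -> R)
    (Y : 'I_n -> {RV P >-> R}) :
  (forall k, is_stable_integral p Z (f k) (Y k)) ->
  \int[P]_w cos (\sum_k theta k * Y k w) =
    expR (- \int[mu]_x (`|\sum_k theta k * f k x| `^ p)) /\
  \int[P]_w sin (\sum_k theta k * Y k w) = 0.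
Proof.
move=> hY.
have /choice[D HD] : forall k, exists D : (nat -> nat) * (nat -> nat -> R) * (nat -> nat -> set R),
    [/\ forall N j, finite_borel (D.2 N j),
      (\int[lebesgue_measure]_x
         (`|\sum_(j < D.1.1 N) D.1.2 N j * \1_(D.2 N j) x - f k x| `^ p)%:E)%E
        @[N --> \oo] --> 0%E &
      forall e : R, 0 < e ->
        P [set w | e <= `|\sum_(j < D.1.1 N) D.1.2 N j * Z (D.2 N j) w - Y k w|]
        @[N --> \oo] --> 0%E].
  by move=> k; have [_ _ [m [c [A H]]]] := hY k; exists (m, c, A).
pose m k := (D k).1.1; pose c k := (D k).1.2; pose A k := (D k).2.
pose s N k x : R := \sum_(j < m k N) c k N j * \1_(A k N j) x.
pose S N k w : R := \sum_(j < m k N) c k N j * Z (A k N j) w.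
have mS N k : measurable_fun [set: T] (S N k).
  by apply: measurable_sum => j; exact: measurable_funM.
have fA k N j : finite_borel (A k N j) by have [fA _ _] := HD k; exact: fA.
have simple N : \int[P]_w cos (\sum_k theta k * S N k w) =
      expR (- \int[mu]_x (`|\sum_k theta k * s N k x| `^ p)) /\
    \int[P]_w sin (\sum_k theta k * S N k w) = 0.
  (* Dependent pairs index the double sum as one simple function, whose sets may overlap. *)
  pose c' (u : {k : 'I_n & 'I_(m k N)}) := theta (tag u) * c (tag u) N (tagged u).
  pose A' (u : {k : 'I_n & 'I_(m k N)}) := A (tag u) N (tagged u).
  have E (g : set R -> R) : \sum_u c' u * g (A' u) =
      \sum_k theta k * \sum_(j < m k N) c k N j * g (A k N j).
    under [RHS]eq_bigr do rewrite mulr_sumr.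
    rewrite (sig_big_dep _ (fun k j => true)
      (fun k (j : 'I_(m k N)) => theta k * (c k N j * g (A k N j))))/=.
    by apply: eq_bigr => u _; rewrite mulrA.
  have [hcos hsin] := stable_simple p0 hZ c' (A := A') (fun u => fA _ _ _).
  have Es x : \sum_u c' u * \1_(A' u) x = \sum_k theta k * s N k x := E (fun B => \1_B x).
  have ES w : \sum_u c' u * Z (A' u) w = \sum_k theta k * S N k w := E (fun B => Z B w).
  split.
    transitivity (\int[P]_w cos (\sum_u c' u * Z (A' u) w)).
      by apply: eq_Rintegral => w _; rewrite ES.
    by rewrite hcos; congr (expR (- _)); apply: eq_Rintegral => x _; rewrite Es.
  by rewrite -[RHS]hsin; apply: eq_Rintegral => w _; rewrite ES.
have mY k : measurable_fun [set: T] (Y k : T -> R) by [].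
have SY k (e : R) : 0 < e -> P [set w | e <= `|S N k w - Y k w|] @[N --> \oo] --> 0%E.
  by have [_ _ H] := HD k; exact: H.
have Ls N k : in_Lp mu p (s N k).
  by apply: in_Lp_sum => // j; apply: in_LpZ => //; exact: in_Lp_indic.
have Lf k : in_Lp mu p (f k) by have [? ? _] := hY k.
have Lsf N k : in_Lp mu p (fun x => s N k x - f k x).
  have := in_LpD p1 (Ls N k) (in_LpZ (-1) (Lf k)).
  by under eq_fun do rewrite mulN1r.
have sf0 k : Lp_norm mu p (fun x => s N k x - f k x) @[N --> \oo] --> 0.
  rewrite -(powR0 (x := p^-1)) ?invr_neq0 ?gt_eqF//.
  apply: powR_cvg; last by rewrite invr_gt0.
  - by move=> N; apply: Rintegral_ge0 => x _; exact: powR_ge0.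
  - by apply: fine_cvg; have [_ H _] := HD k; exact: H.
  - exact: cvg_cst.
pose F N x := \sum_k theta k * s N k x; pose G x := \sum_k theta k * f k x.
have LF N : in_Lp mu p (F N) := in_Lp_sum p1 _ (fun k => in_LpZ (theta k) (Ls N k)).
have LG : in_Lp mu p G := in_Lp_sum p1 _ (fun k => in_LpZ (theta k) (Lf k)).
(* The sign c = 1 or -1 gives F = G + E and G = F + E, hence the triangle inequality in both
   directions. *)
pose E (c : R) N x := \sum_k c * theta k * (s N k x - f k x).
have LE c0 N : in_Lp mu p (E c0 N) :=
  in_Lp_sum p1 _ (fun k => in_LpZ (c0 * theta k) (Lsf N k)).
have nE c0 N : Lp_norm mu p (E c0 N) <=
    `|c0| * \sum_k `|theta k| * Lp_norm mu p (fun x => s N k x - f k x).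
  rewrite (le_trans (Lp_norm_sum p1 _ (fun k => in_LpZ (c0 * theta k) (Lsf N k))))//.
  rewrite mulr_sumr; apply: ler_sum => k _.
  by rewrite (Lp_normZ p1 _ (Lsf N k)) normrM mulrA.
have aux (x y z t q : R) : x <= y + z -> y <= x + t -> t <= q -> z <= q -> `|y - x| <= q.
  by move=> *; rewrite ler_norml; apply/andP; split; lra.
have normF : Lp_norm mu p (F N) @[N --> \oo] --> Lp_norm mu p G.
  have c0 : \sum_k `|theta k| * Lp_norm mu p (fun x => s N k x - f k x) @[N --> \oo] --> 0.
    rewrite [X in _ --> X](_ : 0 = \sum_(k < n) `|theta k| * 0); last first.
      by rewrite big1// => k _; rewrite mulr0.
    by apply: cvg_big => [|k _]; [exact: add_continuous|exact: cvgMr].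
  apply/cvgrPdist_le => e e0; near=> N.
  apply: (@le_trans _ _ (\sum_k `|theta k| * Lp_norm mu p (fun x => s N k x - f k x)));
    last by near: N; exact: (cvgr_le _ c0).
  have FG : F N = fun x => G x + E 1 N x.
    apply/funext => x; rewrite /F /G /E -big_split; apply: eq_bigr => k _ /=.
    by ring.
  have GF : G = fun x => F N x + E (-1) N x.
    apply/funext => x; rewrite /F /G /E -big_split; apply: eq_bigr => k _ /=.
    by ring.
  have D1 := Lp_normD p1 LG (LE 1 N); rewrite -FG in D1.
  have D2 := Lp_normD p1 (LF N) (LE (-1) N); rewrite -GF in D2.
  have := nE 1 N; have := nE (-1) N; rewrite normrN normr1 mul1r => n1 n2.
  exact: aux D1 D2 n1 n2.
have cosE : \int[P]_w cos (\sum_k theta k * S N k w) @[N --> \oo] -->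
    expR (- \int[mu]_x (`|G x| `^ p)).
  under eq_fun do rewrite (simple _).1.
  apply: (@cvg_comp _ _ _ (fun N => - \int[mu]_x (`|F N x| `^ p)) expR); last exact: continuous_expR.
  apply: cvgN; rewrite -(Lp_normX mu p1).
  under eq_fun do rewrite -(Lp_normX mu p1).
  apply: powR_cvg => //; first by move=> N; exact: Lp_norm_ge0.
  exact: cvg_cst.
have bdc := expect_cvg_in_prob (theta := theta) mS mY SY.
have mcos : measurable_fun [set: R] (@cos R).
  by apply: continuous_measurable_fun; exact: continuous_cos.
have msin : measurable_fun [set: R] (@sin R).
  by apply: continuous_measurable_fun; exact: continuous_sin.
split.
  have c1 := bdc _ mcos (@cos_max R) (@cos_dist R).
  by rewrite -(cvg_lim _ c1)// (cvg_lim _ cosE).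
have c1 := bdc _ msin (@sin_max R) (@sin_dist R).
rewrite -(cvg_lim _ c1)//; under eq_fun do rewrite (simple _).2.
by rewrite norm_lim_cst.
Unshelve. all: by end_near. Qed.

End stable_integral.

(** * Affine substitution and an integrable power tail *)

Section lebesgue_integrals.
Set Implicit Arguments.
Unset Strict Implicit.
Context {R : realType}.
Local Notation mu := (@lebesgue_measure R).

Lemma integral_affine (f : R -> R) (u r : R) : 0 < r -> continuous f ->
  (forall x, 0 <= f x) ->
  \int[mu]_x f x = r * \int[mu]_y f (u + r * y).
Proof.
move=> r0 cf f0.
pose F (y : R) := u + r * y.
have cF : continuous F.
  by move=> y; apply: cvgD; [exact: cvg_cst|apply: cvgMr; exact: cvg_id].
have dF (y : R) : is_derive y 1 F r.
  rewrite (_ : F = cst u + r \*: id)//.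
  by apply: is_derive_eq; rewrite add0r /GRing.scale/= mulr1.
have F' : F^`()%classic = cst r.
  by apply/funext => y; rewrite derive1E derive_val.
have sub : (\int[mu]_x (f x)%:E = \int[mu]_y (((f \o F) * F^`()%classic) y)%:E)%E.
  apply: increasing_ge0_integration_by_substitutionT => //.
  - by move=> x y xy; rewrite /F ltrD2l ltr_pM2l.
  - by rewrite F'; exact: cst_continuous.
  - by rewrite F'; exact: is_cvg_cst.
  - by rewrite F'; exact: is_cvg_cst.
  - apply: (@cvg_comp _ _ _ (fun y => r * y) (fun y => u + y)); last exact: cvg_addrl_Ny.
    exact: gt0_cvgMrNy.
  - apply: (@cvg_comp _ _ _ (fun y => r * y) (fun y => u + y)); last exact: cvg_addrl.
    exact: gt0_cvgMry.
have cfF : continuous (f \o F) by move=> y; apply: continuous_comp; [exact: cF|exact: cf].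
rewrite /Rintegral sub.
transitivity (fine (\int[mu]_y (r%:E * (f (F y))%:E)))%E.
  by congr fine; apply: eq_integral => y _; rewrite F' -EFinM [in RHS]mulrC.
rewrite ge0_integralZl ?lee_fin ?(ltW r0)//.
(* Integrability is not assumed: for an infinite integral both sides are read as 0. *)
- case: (\int[mu]_x (f (F x))%:E)%E => [i| |]; first by [].
    by rewrite gt0_muley ?lte_fin//= mulr0.
  by rewrite gt0_muleNy ?lte_fin//= mulr0.
- by apply/measurable_EFinP; exact: (continuous_measurable_fun cfF).
- by move=> y _; rewrite lee_fin; exact: f0.
Qed.

Lemma is_derive_powR (a x : R) : 0 < x ->
  is_derive x 1 (fun y => y `^ a) (a * x `^ (a - 1)).
Proof.
move=> x0; have x0' : x \in `]0, +oo[ by rewrite in_itv/= andbT.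
apply: DeriveDef; first exact: derivable_powR.
by rewrite -derive1E powR_derive1.
Qed.

Lemma powR_cvgy0 (a : R) : a < 0 -> x `^ a @[x --> +oo] --> 0.
Proof.
move=> a0; apply/cvgrPdist_le => e e0; near=> x.
have x0 : 0 < x by near: x; exact: nbhs_pinfty_gt.
rewrite sub0r normrN ger0_norm ?powR_ge0//.
have -> : e = (e `^ a^-1) `^ a by rewrite -powRrM mulVf ?lt_eqF// powRr1 ?ltW.
have -> : a = - (- a) by rewrite opprK.
rewrite !(powRN _ (- a)) lef_pV2 ?posrE ?powR_gt0//.
apply: ge0_ler_powR; rewrite ?oppr_ge0 ?nnegrE ?(ltW a0) ?(ltW x0) ?powR_ge0//.
Unshelve. all: by end_near. Qed.

(** The primitive y^(q + 1) / (q + 1) vanishes at infinity, which settles [1, +oo); the reflection y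
    -> - y carries this to the left tail. *)
Lemma integrable_powR_tail (q : R) : q < -1 ->
  mu.-integrable [set: R] (EFin \o (fun y => \1_`]-oo, (-1)] y * (- y) `^ q)).
Proof.
move=> q1; have q10 : q + 1 < 0 by lra.
have dP (x : R) : 0 < x -> is_derive x 1 (fun y => (q + 1)^-1 * y `^ (q + 1)) (x `^ q).
  move=> x0; have D := is_derive_powR (q + 1) x0.
  rewrite (_ : (fun y => _) = (q + 1)^-1 \*: (fun y : R => y `^ (q + 1)))//.
  by apply: is_derive_eq; rewrite /GRing.scale/= addrK mulKf// lt_eqF.
have cq (x : R) : 0 < x -> {for x, continuous (fun x => x `^ q)}.
  move=> x0; apply: differentiable_continuous; apply/derivable1_diffP.
  by have [] := is_derive_powR q x0.
have I1 : (\int[mu]_(x in `[1%R, +oo[) (x `^ q)%:E =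
    0%:E - ((q + 1)^-1 * 1 `^ (q + 1))%:E)%E.
  apply: (@ge0_continuous_FTC2y _ _ (fun y => (q + 1)^-1 * y `^ (q + 1))).
  - by move=> x _; exact: powR_ge0.
  - apply: continuous_in_subspaceT => x; rewrite inE/= in_itv/= andbT => x1.
    by apply: cq; exact: lt_le_trans x1.
  - rewrite -[X in _ --> X](mulr0 (q + 1)^-1); apply: cvgMr; exact: powR_cvgy0.
  - by move=> x x1; have [] := dP x (lt_trans ltr01 x1).
  - have c1 : {for 1, continuous (fun y => (q + 1)^-1 * y `^ (q + 1))}.
      apply: differentiable_continuous.
      by apply/derivable1_diffP; have [] := dP 1 ltr01.
    exact: (cvg_at_right_filter c1).
  - move=> x; rewrite in_itv/= andbT => x1; rewrite derive1E.
    by have D := dP x (lt_trans ltr01 x1); rewrite derive_val.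
have I2 : (\int[mu]_(x in `]-oo, (-1)%R]) ((- x) `^ q)%:E =
    0%:E - ((q + 1)^-1 * 1 `^ (q + 1))%:E)%E.
  rewrite ge0_integration_by_substitutionNy.
  - by rewrite -I1; apply: eq_integral => x _ /=; rewrite opprK.
  - apply: continuous_in_subspaceT => x; rewrite inE/= in_itv/= => x1.
    apply: (@continuous_comp _ _ _ (@GRing.opp R) (fun y => y `^ q)).
      exact: opp_continuous.
    by apply: cq; lra.
  - by move=> x _; exact: powR_ge0.
have mf : measurable_fun [set: R] (fun y : R => \1_`]-oo, (-1)] y * (- y) `^ q).
  apply: measurable_funM; first exact: measurable_indic.
  apply: (measurableT_comp (f := fun y => y `^ q)); first exact: measurable_powR.
  exact: oppr_measurable.
apply/integrableP; split; first exact/measurable_EFinP.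
suff -> : (\int[mu]_x `|(\1_`]-oo, (-1)] x * (- x) `^ q)%R%:E| =
  \int[mu]_(x in `]-oo, (-1)%R]) ((- x) `^ q)%:E)%E by rewrite I2 ltry.
rewrite [RHS]integral_mkcond; apply: eq_integral => x _.
rewrite gee0_abs/= ?lee_fin ?mulr_ge0 ?powR_ge0// /patch indicE.
by case: (_ \in _); rewrite ?mul1r ?mul0r.
Qed.

End lebesgue_integrals.

(** * The tempered kernel: scaling, continuity and bounds *)

Section tempered_kernel.
Set Implicit Arguments.
Unset Strict Implicit.
Context {R : realType}.
Implicit Types (l g v y z V : R).

Definition tempered_kernel l g v y : R :=
  expR (- (l * pos_part (v - y))) * pos_pow (v - y) g -
  expR (- (l * pos_part (- y))) * pos_pow (- y) g.

Lemma stable_kernelE (H a v y : R) :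
  stable_kernel H a v y = tempered_kernel 0 (H - a^-1) v y.
Proof. by rewrite /tempered_kernel !mul0r oppr0 expR0 !mul1r. Qed.

Lemma pos_part_pMr (r z : R) : 0 < r -> pos_part (r * z) = r * pos_part z.
Proof. by move=> r0; rewrite /pos_part maxr_pMr ?mulr0// ltW. Qed.

Lemma pos_pow_pMr (r z g : R) : 0 < r -> pos_pow (r * z) g = r `^ g * pos_pow z g.
Proof.
move=> r0; rewrite /pos_pow pmulr_rgt0//; case: ltP => z0; last by rewrite mulr0.
by rewrite powRM ?(ltW r0)// ltW.
Qed.

(* Self-similarity of the kernel at the point u, with tempering lambda r at scale r. *)
Lemma G_increment (H lambda u v r y : R) (alpha : R -> R) : 0 < r ->
  G H alpha lambda (u + r * v) (u + r * y) - G H alpha lambda u (u + r * y) =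
  r `^ (H - (alpha (u + r * y))^-1) *
  tempered_kernel (lambda * r) (H - (alpha (u + r * y))^-1) v y.
Proof.
move=> r0; rewrite /G /tempered_kernel; set g := H - _.
rewrite (_ : u + r * v - (u + r * y) = r * (v - y)); last by ring.
rewrite (_ : u - (u + r * y) = r * - y); last by ring.
by rewrite !pos_part_pMr// !pos_pow_pMr//= !mulrA; ring.
Qed.

Lemma pos_part_ge0 z : 0 <= pos_part z.
Proof. by rewrite /pos_part le_max lexx orbT. Qed.

(** For a nonzero exponent the convention at 0 agrees with that of the real power, so the case
    distinction disappears and continuity becomes visible. *)
Lemma pos_powE z g : g != 0 -> pos_pow z g = pos_part z `^ g.
Proof.
move=> g0; rewrite /pos_pow /pos_part; case: ltP => // z0.
by rewrite powR0.
Qed.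

Lemma continuous_pos_part : continuous (@pos_part R).
Proof.
move=> z; apply/cvgrPdist_lt => e e0; near=> t.
apply: (@le_lt_trans _ _ `|z - t|); last by near: t; exact: cvgr_dist_lt.
by rewrite /pos_part ![Num.max _ 0]maxC; exact: maxr_dist_le.
Unshelve. all: by end_near. Qed.

Section limits.
Context (I : Type) (F : set_system I) (FF : ProperFilter F).

Lemma tempered_part_cvg (l g z : I -> R) (l0 g0 z0 : R) : 0 < g0 -> (forall i, 0 < g i) ->
  l i @[i --> F] --> l0 -> g i @[i --> F] --> g0 -> z i @[i --> F] --> z0 ->
  expR (- (l i * pos_part (z i))) * pos_pow (z i) (g i) @[i --> F] -->
  expR (- (l0 * pos_part z0)) * pos_pow z0 g0.
Proof.
move=> g00 gi0 cl cg cz.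
have cp : pos_part (z i) @[i --> F] --> pos_part z0.
  exact: (continuous_cvg _ (@continuous_pos_part z0) cz).
apply: cvgM.
  apply: (@cvg_comp _ _ _ (fun i => - (l i * pos_part (z i))) expR);
    last exact: continuous_expR.
  by apply: cvgN; exact: cvgM.
rewrite pos_powE ?gt_eqF//.
under eq_fun do rewrite pos_powE ?gt_eqF//.
by apply: powR_cvg => // i; exact: pos_part_ge0.
Qed.

Lemma tempered_kernel_cvg (l g v y : I -> R) (l0 g0 v0 y0 : R) :
  0 < g0 -> (forall i, 0 < g i) -> l i @[i --> F] --> l0 ->
  g i @[i --> F] --> g0 -> v i @[i --> F] --> v0 -> y i @[i --> F] --> y0 ->
  tempered_kernel (l i) (g i) (v i) (y i) @[i --> F] --> tempered_kernel l0 g0 v0 y0.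
Proof.
move=> g00 gi0 cl cg cv cy; apply: cvgB.
  by apply: tempered_part_cvg => //; exact: cvgB.
by apply: tempered_part_cvg => //; exact: cvgN.
Qed.

End limits.

(** Makes the derivative bound of the tempered power uniform in the tempering parameter. *)
Lemma mul_expRN_le1 (t : R) : 0 <= t -> t * expR (- t) <= 1.
Proof.
move=> t0; rewrite expRN ler_pdivrMr ?expR_gt0// mul1r.
by rewrite (le_trans _ (expR_ge1Dx t))// lerDr.
Qed.

(** The derivative is t^(g - 1) (g - l t) e^(- l t). Both g e^(- l t) and l t e^(- l t) lie in
    [0, 1], and t^(g - 1) <= m^(g - 1) because g <= 1. *)
Lemma tempered_power_dist (l g m x z : R) : 0 <= l -> 0 < g <= 1 -> 0 < m -> m <= x -> m <= z ->
  `|expR (- (l * z)) * z `^ g - expR (- (l * x)) * x `^ g| <= m `^ (g - 1) * `|z - x|.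
Proof.
move=> l0 /andP[g0 g1] m0.
wlog xz : x z / x <= z.
  move=> H mx mz; have [xz|/ltW zx] := leP x z; first exact: H.
  by rewrite distrC [`|z - x|]distrC; exact: H.
move=> mx mz; rewrite [`|z - x|]ger0_norm ?subr_ge0//.
pose df t := expR (- (l * t)) * (g * t `^ (g - 1)) + - l * expR (- (l * t)) * t `^ g.
apply: (@derive_bound_dist _ (fun t => expR (- (l * t)) * t `^ g) df) => //.
  move=> t /andP[xt _]; have t0 : 0 < t by rewrite (lt_le_trans m0)// (le_trans mx).
  have dlin : is_derive t 1 (fun t : R => - (l * t)) (- l).
    rewrite (_ : (fun _ => _) = - l \*: id); last by apply/funext => ?; rewrite -mulNr.
    by apply: is_derive_eq; rewrite /GRing.scale/= mulr1.
  have dexp : is_derive t 1 (fun t : R => expR (- (l * t))) (- l * expR (- (l * t))).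
    rewrite mulrC; exact: is_derive1_comp.
  have dpow := is_derive_powR g t0.
  rewrite (_ : (fun _ => _) = (fun t : R => expR (- (l * t))) * (fun t => t `^ g))//.
  by apply: is_derive_eq; rewrite /df/= /GRing.scale/=; ring.
move=> t /andP[xt _]; have mt : m <= t by exact: le_trans xt.
have t0 : 0 < t by exact: lt_le_trans mt.
have tg : t `^ g = t * t `^ (g - 1) by rewrite mulr_powRB1// ltW.
have -> : df t = t `^ (g - 1) * (g * expR (- (l * t)) - (l * t) * expR (- (l * t))).
  by rewrite /df tg; ring.
rewrite normrM ger0_norm ?powR_ge0// -[leRHS]mulr1 ler_pM ?powR_ge0//.
  rewrite -[g - 1]opprK !(powRN _ (- (g - 1))) lef_pV2 ?posrE ?powR_gt0//.
  by apply: ge0_ler_powR; rewrite ?nnegrE ?oppr_ge0 ?subr_le0 ?(ltW m0) ?(ltW t0).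
have lt0 : 0 <= l * t by exact: mulr_ge0 l0 (ltW t0).
have e0 : 0 < expR (- (l * t)) by exact: expR_gt0.
have e1 : expR (- (l * t)) <= 1 by rewrite -expR0 ler_expR oppr_le0.
have h1 := mul_expRN_le1 lt0.
have h2 : 0 <= l * t * expR (- (l * t)) by exact: mulr_ge0 lt0 (ltW e0).
have h3 : 0 <= g * expR (- (l * t)) by exact: mulr_ge0 (ltW g0) (ltW e0).
have h4 : g * expR (- (l * t)) <= 1 by rewrite mulr_ile1 ?(ltW g0) ?(ltW e0).
by rewrite ler_norml; apply/andP; split; lra.
Qed.

Lemma tempered_part_bound (l g z V : R) : 0 <= l -> 0 < g <= 1 -> 1 <= V -> z <= V ->
  0 <= expR (- (l * pos_part z)) * pos_pow z g <= V.
Proof.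
move=> l0 /andP[g0 g1] V1 zV; rewrite pos_powE ?gt_eqF//.
rewrite mulr_ge0 ?expR_ge0 ?powR_ge0//= -[leRHS]mul1r ler_pM ?expR_ge0 ?powR_ge0//.
  by rewrite -expR0 ler_expR oppr_le0 mulr_ge0// pos_part_ge0.
apply: (@le_trans _ _ (V `^ g)); last exact: ler1_powR.
have V0 : 0 <= V by exact: le_trans V1.
apply: ge0_ler_powR; rewrite ?nnegrE ?pos_part_ge0 ?(ltW g0)//.
by rewrite /pos_part ge_max zV (le_trans ler01).
Qed.

(** Both v - y and - y are at most 3 V, so the two terms lie in [0, 3 V] and so does the modulus of
    their difference. *)
Lemma tempered_kernel_near (l g v y V : R) : 0 <= l -> 0 < g <= 1 -> 1 <= V ->
  `|v| <= V -> - (2 * V) <= y -> `|tempered_kernel l g v y| <= 3 * V.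
Proof.
move=> l0 g01 V1; rewrite ler_norml => /andP[vV0 vV1] yV.
have V3 : 1 <= 3 * V by lra.
have vy3 : v - y <= 3 * V by lra.
have y3 : - y <= 3 * V by lra.
have /andP[a0 a1] := tempered_part_bound l0 g01 V3 vy3.
have /andP[b0 b1] := tempered_part_bound l0 g01 V3 y3.
by rewrite /tempered_kernel ler_norml; apply/andP; split; lra.
Qed.

Lemma tempered_kernel_right (l g v y V : R) : 0 <= V -> `|v| <= V -> V <= y ->
  tempered_kernel l g v y = 0.
Proof.
move=> V0; rewrite ler_norml => /andP[_ vV] Vy; rewrite /tempered_kernel /pos_pow.
by rewrite !ifF ?mulr0 ?subrr//; apply/negbTE; rewrite -leNgt; lra.
Qed.

(** Far to the left v - y and - y both exceed - y / 2, and they differ by v; the factor 2 bounds the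
    2^(1 - g) released by the halving. *)
Lemma tempered_kernel_left (l g v y V : R) : 0 <= l -> 0 < g <= 1 -> 1 <= V ->
  `|v| <= V -> y <= - (2 * V) -> `|tempered_kernel l g v y| <= 2 * V * (- y) `^ (g - 1).
Proof.
move=> l0 g01 V1 vV yV; have /andP[vV0 vV1] : - V <= v <= V by rewrite -ler_norml.
have /andP[g0 g1] := g01.
have y2 : 0 < - y / 2 by lra.
have vy : - y / 2 <= v - y by lra.
have yy : - y / 2 <= - y by lra.
rewrite /tempered_kernel /pos_pow /pos_part !ifT; [|lra|lra].
rewrite !max_l; [|lra|lra].
apply: le_trans (tempered_power_dist l0 g01 y2 yy vy) _.
rewrite (_ : v - y - - y = v); last by ring.
rewrite mulrC [2 * V]mulrC -mulrA ler_pM ?powR_ge0//.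
rewrite powRM ?invr_ge0//; last by lra.
rewrite mulrC ler_wpM2r ?powR_ge0//.
rewrite -powR_inv1// -powRrM mulN1r opprB.
by rewrite -[leRHS]powRr1// ler_powR ?ler1n// lerBlDr lerDl ltW.
Qed.

End tempered_kernel.

(** * An integrable bound uniform in the exponent and the tempering *)

Section domination.
Set Implicit Arguments.
Unset Strict Implicit.
Context {R : realType} (H : R).
Hypothesis H1 : H < 1.
Local Notation mu := (@lebesgue_measure R).

(** The square absorbs all exponents q <= 2, since 3 V W >= 1 for V, W >= 1. Cutting the tail at -1
    keeps it independent of V and covers y < - 2 V. *)
Definition kernel_bound (V W y : R) : R :=
  (3 * V * W) ^+ 2 *
  (\1_`[- (2 * V), V] y + \1_`]-oo, (-1)] y * (- y) `^ (H - 2)).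

Lemma kernel_bound_ge0 (V W y : R) : 0 <= kernel_bound V W y.
Proof.
by rewrite /kernel_bound mulr_ge0 ?sqr_ge0// addr_ge0// mulr_ge0 ?powR_ge0.
Qed.

Lemma kernel_bound_integrable (V W : R) :
  mu.-integrable [set: R] (EFin \o kernel_bound V W).
Proof.
rewrite (_ : EFin \o _ = fun y => ((3 * V * W) ^+ 2)%:E *
    ((\1_`[- (2 * V), V] y)%:E + (\1_`]-oo, (-1)] y * (- y) `^ (H - 2))%R%:E))%E//.
apply: integrableZl => //; apply: integrableD => //.
  exact: integrable_indic_itv.
have q1 : H - 2 < -1 by move: H1 => h; lra.
exact: integrable_powR_tail.
Qed.

Lemma kernel_sum_bound (n : nat) (theta v : 'I_n -> R) (V W l q y : R) :
  1 <= V -> 1 <= W -> (forall k, `|v k| <= V) -> \sum_k `|theta k| <= W ->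
  0 <= l -> 1 <= q <= 2 -> 0 < H - q^-1 ->
  `|\sum_k theta k * tempered_kernel l (H - q^-1) (v k) y| `^ q <= kernel_bound V W y.
Proof.
move=> V1 W1 vV tW l0 /andP[q1 q2] g0; have q0 : 0 < q by exact: lt_le_trans q1.
have qV : 0 < q^-1 by rewrite invr_gt0.
have g01 : 0 < H - q^-1 <= 1 by move: H1 => h; apply/andP; split; lra.
have V0 : 0 <= V by exact: le_trans V1.
have W0 : 0 <= W by exact: le_trans W1.
have A1 : 1 <= 3 * V * W by rewrite -[leLHS]mulr1 ler_pM//; lra.
have A0 : 0 <= 3 * V * W by exact: le_trans A1.
have A2 : (3 * V * W) `^ q <= (3 * V * W) ^+ 2.
  by rewrite -powR_mulrn// ler_powR.
have sumB M : 0 <= M -> (forall k, `|tempered_kernel l (H - q^-1) (v k) y| <= M) ->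
    `|\sum_k theta k * tempered_kernel l (H - q^-1) (v k) y| <= W * M.
  move=> M0 KM; rewrite (le_trans (ler_norm_sum _ _ _))//.
  apply: (@le_trans _ _ (\sum_k `|theta k| * M)).
    by apply: ler_sum => k _; rewrite normrM ler_wpM2l.
  by rewrite -mulr_suml ler_wpM2r.
have [Vy|yV] := leP V y.
  rewrite big1 ?normr0 ?powR0 ?gt_eqF ?kernel_bound_ge0// => k _.
  by rewrite (tempered_kernel_right _ _ V0 (vV k) Vy) mulr0.
have [yV2|yV2] := leP (- (2 * V)) y.
  apply: (@le_trans _ _ ((3 * V * W) `^ q)).
    apply: ge0_ler_powR; rewrite ?nnegrE ?(ltW q0)//.
    rewrite [leRHS]mulrC; apply: sumB; first by lra.
    by move=> k; exact: tempered_kernel_near.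
  rewrite (le_trans A2)// /kernel_bound ler_peMr ?sqr_ge0//.
  rewrite indicE mem_set ?lerDl ?mulr_ge0 ?powR_ge0//=.
  by rewrite in_itv/= yV2 ltW.
have s1 : 1 <= - y by lra.
have s0 : 0 <= - y by lra.
apply: (@le_trans _ _ ((3 * V * W * (- y) `^ (H - q^-1 - 1)) `^ q)).
  apply: ge0_ler_powR; rewrite ?nnegrE ?mulr_ge0 ?powR_ge0 ?(ltW q0)//.
  rewrite (le_trans (sumB (2 * V * (- y) `^ (H - q^-1 - 1)) _ _))//.
  - by rewrite mulr_ge0 ?powR_ge0//; lra.
  - by move=> k; apply: tempered_kernel_left => //; exact: ltW.
  - rewrite mulrA ler_wpM2r ?powR_ge0// [leLHS]mulrC ler_wpM2r//; lra.
rewrite powRM ?powR_ge0// /kernel_bound ler_pM ?powR_ge0//.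
rewrite -powRrM [X in _ <= _ + X * _]indicE mem_set; last first.
  by rewrite /= in_itv/= lerNr.
rewrite mul1r (@le_trans _ _ ((- y) `^ (H - 2)))//; last by rewrite lerDr.
apply: ler_powR => //.
(* As H < 1 and q >= 1, this is at most H - 2, which is below -1: the decay is integrable uniformly
   in q. *)
rewrite (_ : (H - q^-1 - 1) * q = (H - 1) * q - 1); last first.
  by field; rewrite gt_eqF.
by have h := H1; nra.
Qed.

End domination.

(** * The exponent of the rescaled increments and its limit *)

Section local_density.
Set Implicit Arguments.
Unset Strict Implicit.
Context {R : realType} (a b : R) (alpha : R -> R) (lambda H : R).
Hypotheses (ha : 0 < a) (hb : b <= 2) (halpha : forall x, a <= alpha x <= b)
  (calpha : continuous alpha) (hlambda : 0 < lambda) (hH : a^-1 < H < 1).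
Variables (u : R) (n : nat) (theta v : 'I_n -> R).
Local Notation mu := (@lebesgue_measure R).

Lemma alpha_bounds x : [/\ 1 <= alpha x, alpha x <= 2 & 0 < H - (alpha x)^-1].
Proof.
have /andP[ax xb] := halpha x; have /andP[aH H1] := hH.
have a1 : 1 < a by rewrite -invf_lt1 ?(lt_trans aH).
split; [by rewrite (le_trans (ltW a1))|exact: le_trans hb|].
by rewrite subr_gt0 (le_lt_trans _ aH)// lef_pV2 ?posrE// (lt_le_trans ha).
Qed.

Lemma alpha_gt0 x : 0 < alpha x.
Proof. by have [h _ _] := alpha_bounds x; exact: lt_le_trans h. Qed.

(* Integrand of the exponent of the rescaled increments at scale r; r = 0 gives the tangent process. *)
Definition local_density (r y : R) : R :=
  `|\sum_k theta k * tempered_kernel (lambda * r)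
      (H - (alpha (u + r * y))^-1) (v k) y| `^ alpha (u + r * y).

Lemma local_density0 y : local_density 0 y =
  `|\sum_k theta k * stable_kernel H (alpha u) (v k) y| `^ alpha u.
Proof.
rewrite /local_density mul0r addr0 mulr0.
by under eq_bigr do rewrite -stable_kernelE.
Qed.

(** Stated along an arbitrary filter with both r and y moving, so that it yields continuity in y,
    hence measurability, as well as the limit r -> 0. *)
Lemma local_density_cvg (I : Type) (F : set_system I) (FF : ProperFilter F)
    (r y : I -> R) (r0 y0 : R) :
  r i @[i --> F] --> r0 -> y i @[i --> F] --> y0 ->
  local_density (r i) (y i) @[i --> F] --> local_density r0 y0.
Proof.
move=> cr cy.
have cx : u + r i * y i @[i --> F] --> u + r0 * y0.
  by apply: cvgD; [exact: cvg_cst|exact: cvgM].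
have ca : alpha (u + r i * y i) @[i --> F] --> alpha (u + r0 * y0).
  exact: (@cvg_comp _ _ _ (fun i => u + r i * y i) alpha _ _ _ cx (@calpha (u + r0 * y0))).
apply: powR_cvg => //; last exact: alpha_gt0.
apply: cvg_norm; apply: cvg_big => [|k _]; first exact: add_continuous.
apply: cvgMr; apply: tempered_kernel_cvg => //.
- by have [] := alpha_bounds (u + r0 * y0).
- by move=> i; have [] := alpha_bounds (u + r i * y i).
- exact: cvgMr.
- apply: cvgB; first exact: cvg_cst.
  by apply: cvgV => //; rewrite gt_eqF// alpha_gt0.
- exact: cvg_cst.
Qed.

Lemma measurable_local_density r : measurable_fun [set: R] (local_density r).
Proof.
apply: continuous_measurable_fun => y.
by apply: (@local_density_cvg R (nbhs y) _ (fun=> r) id r y); [exact: cvg_cst|exact: cvg_id].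
Qed.

Variables (V W : R).
Hypotheses (V1 : 1 <= V) (W1 : 1 <= W) (vV : forall k, `|v k| <= V)
  (tW : \sum_k `|theta k| <= W).

Lemma local_density_bound r y : 0 <= r -> local_density r y <= kernel_bound H V W y.
Proof.
move=> r0; have [q1 q2 g0] := alpha_bounds (u + r * y).
have /andP[_ H1] := hH.
by apply: kernel_sum_bound => //; [rewrite mulr_ge0// ltW|rewrite q1].
Qed.

Lemma local_density_integrable r : 0 <= r ->
  mu.-integrable [set: R] (EFin \o local_density r).
Proof.
have /andP[_ H1] := hH.
move=> r0; apply: (le_integrable measurableT _ _ (kernel_bound_integrable H1 V W)).
  apply/measurable_EFinP; exact: measurable_local_density.
move=> y _ /=; rewrite lee_fin !ger0_norm ?powR_ge0 ?kernel_bound_ge0//.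
exact: local_density_bound.
Qed.

Lemma integral_local_density_cvg (r : nat -> R) : (forall m, 0 <= r m) ->
  r m @[m --> \oo] --> 0 ->
  \int[mu]_y local_density (r m) y @[m --> \oo] --> \int[mu]_y local_density 0 y.
Proof.
move=> r0 cr; have /andP[_ H1] := hH.
have [||||_ _ c] := @dominated_convergence _ _ R mu setT measurableT
  (fun m => EFin \o local_density (r m)) (EFin \o local_density 0)
  (EFin \o kernel_bound H V W) _ _ _ (kernel_bound_integrable H1 V W).
- by move=> m; apply/measurable_EFinP; exact: measurable_local_density.
- by apply/measurable_EFinP; exact: measurable_local_density.
- apply: aeW => y _; apply: cvg_EFin; first exact: nearW.
  by apply: (@local_density_cvg nat \oo _ r (fun=> y) 0 y); [exact: cr|exact: cvg_cst].
- apply: aeW => y m _ /=; rewrite lee_fin ger0_norm ?powR_ge0//.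
  exact: local_density_bound.
apply: fine_cvg; rewrite fineK; first exact: c.
by apply: integrable_fin_num => //; exact: local_density_integrable.
Qed.

End local_density.

(** * Characteristic functions and tightness of the rescaled increments *)

Section increments.
Set Implicit Arguments.
Unset Strict Implicit.
Context {R : realType} (a b : R) (alpha : R -> R) (lambda H : R).
Hypotheses (ha : 0 < a) (hb : b <= 2) (halpha : forall x, a <= alpha x <= b)
  (calpha : continuous alpha) (hlambda : 0 < lambda) (hH : a^-1 < H < 1).
Context {d : measure_display} {T : measurableType d} (P : probability T R)
  (X : R -> {RV P >-> R}) (hX : is_LTFmSM H alpha lambda X) (u : R).
Local Notation mu := (@lebesgue_measure R).

Lemma increments_cis (n : nat) (theta v : 'I_n -> R) (r : R) : 0 < r ->
  \int[P]_w cos (\sum_k theta k * ((X (u + r * v k) w - X u w) / r `^ H)) =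
    expR (- \int[mu]_y local_density alpha lambda H u theta v r y) /\
  \int[P]_w sin (\sum_k theta k * ((X (u + r * v k) w - X u w) / r `^ H)) = 0.
Proof.
move=> r0; have rH : 0 < r `^ H by exact: powR_gt0.
(* A combination of n increments is one of n + 1 values of X; the base point u receives minus the
   sum of the other weights. *)
pose th (i : 'I_n.+1) := if unlift ord0 i is Some k then theta k / r `^ H
  else - \sum_k theta k / r `^ H.
pose t (i : 'I_n.+1) := if unlift ord0 i is Some k then u + r * v k else u.
have E (g : R -> R) : \sum_i th i * g (t i) =
    \sum_k theta k * ((g (u + r * v k) - g u) / r `^ H).
  rewrite big_ord_recl (eq_bigr (fun k => theta k / r `^ H * g (u + r * v k))); last first.
    by move=> k _; rewrite /th /t liftK.
  rewrite /th /t unlift_none mulNr mulr_suml addrC -sumrB; apply: eq_bigr => k _.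
  by ring.
have /expect_cisP[hc hs] := hX th t.
have bounds := alpha_bounds ha hb halpha hH.
pose f x := `|\sum_i th i * G H alpha lambda (t i) x| `^ alpha x.
have f0 x : 0 <= f x by exact: powR_ge0.
(* The affine substitution below asks for a continuous integrand. *)
have cf : continuous f.
  move=> x; have [_ _ g0] := bounds x.
  apply: (@powR_cvg _ _ (nbhs x) _ (fun z => `|\sum_i th i * G H alpha lambda (t i) z|) alpha) => //;
    [|exact: calpha|exact: (alpha_gt0 ha hb halpha hH)].
  apply: cvg_norm; apply: cvg_big => [|i _]; first exact: add_continuous.
  have cg : H - (alpha z)^-1 @[z --> x] --> H - (alpha x)^-1.
    apply: cvgB; first exact: cvg_cst.
    by apply: cvgV; [rewrite gt_eqF// (alpha_gt0 ha hb halpha hH)|exact: calpha].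
  apply: cvgMr; apply: cvgB; apply: tempered_part_cvg => //.
  - by move=> z; have [] := bounds z.
  - exact: cvg_cst.
  - by apply: cvgB; [exact: cvg_cst|exact: cvg_id].
  - by move=> z; have [] := bounds z.
  - exact: cvg_cst.
  - by apply: cvgN; exact: cvg_id.
(* The remaining factor r^(-1/alpha(z)) raised to the power alpha(z) is r^(-1), independently of
   z. *)
have fE y : f (u + r * y) = r^-1 * local_density alpha lambda H u theta v r y.
  rewrite /f (E (fun t => G H alpha lambda t (u + r * y))) /local_density.
  set z := u + r * y; have az := alpha_gt0 ha hb halpha hH z.
  rewrite (_ : \sum_k _ = r `^ (- (alpha z)^-1) *
      \sum_k theta k * tempered_kernel (lambda * r) (H - (alpha z)^-1) (v k) y).
    rewrite normrM powRM// ger0_norm ?powR_ge0// -powRrM mulNr mulVf ?gt_eqF//.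
    by rewrite powR_inv1// ltW.
  rewrite mulr_sumr; apply: eq_bigr => k _; rewrite G_increment// -/z.
  have -> : r `^ (H - (alpha z)^-1) = r `^ H * r `^ (- (alpha z)^-1).
    by rewrite powRD//; apply/implyP => _; rewrite gt_eqF.
  by field; rewrite gt_eqF.
have I : \int[mu]_x f x = \int[mu]_y local_density alpha lambda H u theta v r y.
  rewrite (integral_affine u r0 cf f0).
  under eq_Rintegral do rewrite fE.
  rewrite RintegralZl ?mulVKf ?gt_eqF//.
  apply: (local_density_integrable ha hb halpha calpha hlambda hH u
    (V := 1 + \sum_k `|v k|) (W := 1 + \sum_k `|theta k|)); last exact: ltW.
  - by rewrite lerDl sumr_ge0.
  - by rewrite lerDl sumr_ge0.
  - move=> k; rewrite (bigD1 k)//= addrCA lerDl addr_ge0// sumr_ge0//.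
  - by rewrite lerDr.
split.
  rewrite -I -hc; apply: eq_Rintegral => w _.
  by rewrite -(E (fun s => X s w)).
by rewrite -[RHS]hs; apply: eq_Rintegral => w _; rewrite -(E (fun s => X s w)).
Qed.

(** Combine 1 - e^(-J) <= J with t^alpha <= t, valid for alpha >= 1 and t <= 1. The constant is free
    of r, which is what tightness along r -> 0 demands. *)
Lemma increments_tight (V r v t : R) : 1 <= V -> `|v| <= V -> 0 < r -> 0 < t <= 1 ->
  1 - \int[P]_w cos (t * ((X (u + r * v) w - X u w) / r `^ H)) <=
  (\int[mu]_y kernel_bound H V 1 y) * t.
Proof.
move=> V1 vV r0 /andP[t0 t1]; have /andP[_ H1] := hH.
pose D s := local_density alpha lambda H u (fun _ : 'I_1 => s) (fun=> v) r.
have [hc _] := increments_cis (fun _ : 'I_1 => t) (fun=> v) r0.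
rewrite (eq_Rintegral _ (g := fun w => cos (\sum_(k < 1) t * ((X (u + r * v) w - X u w) / r `^ H)))); last first.
  by move=> w _; rewrite big_ord1.
rewrite hc (@le_trans _ _ (\int[mu]_y D t y))//.
  by rewrite lerBlDl -lerBlDr (le_trans _ (expR_ge1Dx _)).
have W1 s : `|s| <= 1 -> \sum_(k < 1) `|s| <= 1 by rewrite big_ord1.
have iD s : `|s| <= 1 -> mu.-integrable [set: R] (EFin \o D s).
  move=> s1; apply: (local_density_integrable ha hb halpha calpha hlambda hH u V1 (lexx 1)) => //.
    exact: W1.
  exact: ltW.
rewrite -RintegralZr//; last exact: kernel_bound_integrable.
have tn1 : `|t| <= 1 by rewrite ger0_norm// ltW.
apply: le_Rintegral => //.
- exact: iD.
- rewrite (_ : EFin \o _ = fun y => (kernel_bound H V 1 y)%:E * t%:E)%E//.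
  by apply: integrableZr => //; exact: kernel_bound_integrable.
move=> y _; have [q1 q2 g0] := alpha_bounds ha hb halpha hH (u + r * y).
have -> : D t y = t `^ alpha (u + r * y) * D 1 y.
  rewrite /D /local_density !big_ord1 mul1r normrM powRM// ger0_norm//.
  exact: ltW.
rewrite mulrC ler_pM ?powR_ge0//.
  apply: (local_density_bound ha hb halpha hlambda hH u V1 (lexx 1)) => //.
    by rewrite big_ord1 normr1.
  exact: ltW.
by apply: ge1r_powR => //; rewrite t0.
Qed.

End increments.

(** * The tangent process does not vanish *)

Section tangent_nontrivial.
Set Implicit Arguments.
Unset Strict Implicit.
Context {R : realType} (H p : R).
Hypotheses (p1 : 1 <= p) (Hp : 0 < H - p^-1).
Local Notation mu := (@lebesgue_measure R).

(** On [0, 1/2] the second power vanishes and the first is at least (1/2)^(H - 1/p). *)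
Lemma integral_stable_kernel_gt0 :
  mu.-integrable [set: R] (EFin \o (fun y => `|stable_kernel H p 1 y| `^ p)) ->
  0 < \int[mu]_y (`|stable_kernel H p 1 y| `^ p).
Proof.
move=> iK; pose c : R := (2^-1 `^ (H - p^-1)) `^ p.
have c0 : 0 < c by rewrite !powR_gt0.
have i1 : mu.-integrable [set: R] (EFin \o (fun y => c * \1_`[0, 2^-1] y)).
  rewrite (_ : EFin \o _ = fun y => c%:E * (\1_`[0, 2^-1] y)%:E)%E//.
  by apply: integrableZl => //; exact: integrable_indic_itv.
apply: (@lt_le_trans _ _ (\int[mu]_y (c * \1_`[0, 2^-1] y))); last first.
  apply: le_Rintegral => // y _; rewrite indicE.
  have [/set_mem/=|_] := boolP (y \in _); last by rewrite mulr0 powR_ge0.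
  rewrite in_itv/= => /andP[y0 y1]; rewrite mulr1 /c.
  have p0 : 0 <= p by exact: le_trans p1.
  apply: ge0_ler_powR; rewrite ?nnegrE ?powR_ge0//.
  rewrite /stable_kernel /pos_pow ifT; last by lra.
  rewrite ifF ?subr0; last by apply/negbTE; rewrite -leNgt; lra.
  rewrite ger0_norm ?powR_ge0//; apply: ge0_ler_powR; rewrite ?nnegrE ?(ltW Hp)//; lra.
rewrite RintegralZl//; last exact: integrable_indic_itv.
have L : (\int[mu]_y (\1_`[0%R, 2^-1%R] y)%:E = (2^-1)%:E)%E.
  rewrite integral_indic// setIT; have := @lebesgue_measure_itv R `[0, 2^-1].
  by rewrite /= lte_fin invr_gt0 ltr0n oppr0 adde0.
by rewrite mulr_gt0// /Rintegral L /= invr_gt0.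
Qed.

End tangent_nontrivial.

Theorem proposition19 (R : realType) (a b : R) (alpha : R -> R) (lambda H : R)
    (ha : 0 < a) (hab : a <= b) (hb : b <= 2)
    (halpha : forall x, a <= alpha x <= b) (calpha : continuous alpha)
    (hlambda : 0 < lambda) (hH : a^-1 < H < 1)
    (d : measure_display) (T : measurableType d) (P : probability T R)
    (X : R -> {RV P >-> R}) (hX : is_LTFmSM H alpha lambda X)
    (u : R)
    (d' : measure_display) (T' : measurableType d') (P' : probability T' R)
    (Z : set R -> {RV P' >-> R}) (hZ : stable_random_measure (alpha u) Z)
    (Y : R -> {RV P' >-> R})
    (hY : forall t, is_stable_integral (alpha u) Z
                      (stable_kernel H (alpha u) t) (Y t)) :
  localisable X H u /\ tangent_process X H u Y.

Proof.
have /andP[aH H1] := hH.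
have H0 : 0 < H by rewrite (lt_trans _ aH)// invr_gt0.
have [p1 _ g0] := alpha_bounds ha hb halpha hH u.
suff tangent : tangent_process X H u Y by split=> //; split=> //; exists d', T', P', Y.
have mX t : measurable_fun [set: T] (X t : T -> R) by [].
have mY t : measurable_fun [set: T'] (Y t : T' -> R) by [].
split.
  (* If Y 1 vanished almost surely, its characteristic function at 1 would be 1, whereas it is
     e^(-J) with J > 0. *)
  exists 1 => Y0.
  have iK := local_density_integrable ha hb halpha calpha hlambda hH u (n := 1)
    (theta := fun=> 1) (v := fun=> 1) (V := 1) (W := 1) (lexx 1) (lexx 1) _ _ (lexx 0).
  have {}iK : (@lebesgue_measure R).-integrable [set: R]
      (EFin \o (fun y => `|stable_kernel H (alpha u) 1 y| `^ alpha u)).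
    rewrite (_ : EFin \o _ = EFin \o local_density alpha lambda H u (fun _ : 'I_1 => 1) (fun=> 1) 0).
      by apply: iK; rewrite ?big_ord1 normr1.
    by apply/funext => y /=; rewrite local_density0 big_ord1 mul1r.
  have := integral_stable_kernel_gt0 p1 g0 iK.
  have [cosY _] := stable_integral_cis p1 hZ (fun _ : 'I_1 => 1) (fun k => hY 1).
  have : expR (- \int[lebesgue_measure]_y (`|stable_kernel H (alpha u) 1 y| `^ alpha u)) = 1.
    transitivity (\int[P']_w cos (\sum_(k < 1) 1 * Y 1 w)).
      rewrite cosY; congr (expR (- _)); apply: eq_Rintegral => y _.
      by rewrite big_ord1 mul1r.
    rewrite -[RHS](expect_cst P'); apply: expect_ae_eq.
    - by apply: bmeas_cos; apply: measurable_sum => k; exact: measurable_funM.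
    - exact: bmeas_cst.
    - by apply: filterS Y0 => w Yw; rewrite big_ord1 Yw mulr0 cos0.
  move: (\int[_]_y _) => J expJ J0; have : expR (- J) < 1 by rewrite expR_lt1 oppr_lt0.
  by rewrite expJ ltxx.
(* The limit r -> 0+ is tested along sequences, as dominated convergence requires. *)
move=> n v f cf bf; apply/cvg_at_rightP => r [r0 cr].
pose S m k w := (X (u + r m * v k) w - X u w) / r m `^ H.
have mS m k : measurable_fun [set: T] (S m k).
  by apply: measurable_funM => //; exact: measurable_funB.
pose V := 1 + \sum_k `|v k|.
have V1 : 1 <= V by rewrite lerDl sumr_ge0.
have vV k : `|v k| <= V.
  by rewrite /V (bigD1 k)//= addrCA lerDl addr_ge0// sumr_ge0.
have inc theta m := increments_cis ha hb halpha calpha hlambda hH hX u theta v (r0 m).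
have lim theta := stable_integral_cis p1 hZ theta (fun k => hY (v k)).
have Icvg theta : \int[lebesgue_measure]_y local_density alpha lambda H u theta v (r m) y
    @[m --> \oo] --> \int[lebesgue_measure]_y
      (`|\sum_k theta k * stable_kernel H (alpha u) (v k) y| `^ alpha u).
  have W1 : 1 <= 1 + \sum_k `|theta k| by rewrite lerDl sumr_ge0.
  have -> : \int[lebesgue_measure]_y
      (`|\sum_k theta k * stable_kernel H (alpha u) (v k) y| `^ alpha u) =
      \int[lebesgue_measure]_y local_density alpha lambda H u theta v 0 y.
    by apply: eq_Rintegral => y _; rewrite local_density0.
  have tW : \sum_k `|theta k| <= 1 + \sum_k `|theta k| by rewrite lerDr.
  exact: (integral_local_density_cvg ha hb halpha calpha hlambda hH V1 W1 vV tW
    (fun m => ltW (r0 m)) cr).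
(* The tightness constant takes W = 1, since only one coordinate with |t| <= 1 is tested at a
   time. *)
apply: (@levy_continuity _ _ _ P _ _ P' n S (fun k => Y (v k)) mS (fun k => mY _) _ _
  (\int[lebesgue_measure]_y kernel_bound H V 1 y)) => //.
- move=> theta; rewrite (lim theta).1; under eq_fun do rewrite (inc theta _).1.
  apply: (@cvg_comp _ _ _ (fun m => - \int[lebesgue_measure]_y
    local_density alpha lambda H u theta v (r m) y) expR); last exact: continuous_expR.
  by apply: cvgN; exact: Icvg.
- move=> theta; rewrite (lim theta).2; under eq_fun do rewrite (inc theta _).2.
  exact: cvg_cst.
- by apply: Rintegral_ge0 => y _; exact: kernel_bound_ge0.
- by move=> m k t t01; exact: (increments_tight ha hb halpha calpha hlambda hH hX).
Qed.
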